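(* Let $l\ge1$ be an integer, $h$ a cusp form of weight two for $\Gamma_0(l)$, $i\in\mathbb{Z}/l\mathbb{Z}$, and $\chi:(\mathbb{Z}/l\mathbb{Z})^*\to\mathbb{C}^*$ a character. For every integer $k\ge3$ the functions $E_{k,i;h}(\tau)$ and $\hat E_{k,\chi;h}(\tau)$ are $h$-twisted modular forms of weight $k$ for $\Gamma_1(l)$.
   Context: $\Gamma_0(l)$ is the group of matrices $\begin{pmatrix}a&b\\c&d\end{pmatrix}\in SL_2(\mathbb{Z})$ with $c\in l\mathbb{Z}$; $\Gamma_1(l)\subset\Gamma_0(l)$ is the subgroup of matrices with diagonal entries $\equiv1\bmod l$. Put $H(\tau)=\int_{i\infty}^{\tau}h(s)\,ds$. For $c\in l\mathbb{Z}$, $c\ne0$, $d\in\mathbb{Z}$, $\gcd(d,l)=1$, $H(-\frac dc)=\int_{i\infty}^{-d/c}h(s)\,ds$ (integral between cusps, convergent because $h$ is a cusp form); convention: $H(-\frac d0)=0$. Write $i_0=\sqrt{-1}$. The series are $$\hat E_{k,\chi;h}(\tau)=\sum_{c\in l\mathbb{Z}}\ \sum_{d\in\mathbb{Z},\,\gcd(c,d)=1}(c\tau+d)^{-k}\chi(d)\,e^{2\pi i_0\,\mathrm{Re}\,H(-\frac dc)},$$ $$E_{k,i;h}(\tau)=\sum_{c\in l\mathbb{Z}}\ \sum_{d\in\mathbb{Z},\,\gcd(l,d)=1}(c\tau+d)^{-k}e^{-2\pi i_0\frac{di}{l}}\,e^{2\pi i_0\,\mathrm{Re}\,H(-\frac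 dc)},$$ where in the latter $(c,d)=(0,0)$ is excluded (automatic for $l\ge2$). An $h$-twisted modular form of weight $k$ with respect to $\Gamma_1(l)$ is a holomorphic function $f$ on the upper half plane such that (1) for every $\begin{pmatrix}a&b\\c&d\end{pmatrix}\in\Gamma_1(l)$, $f\big(\frac{a\tau+b}{c\tau+d}\big)=(c\tau+d)^kf(\tau)\,e^{-2\pi i_0\,\mathrm{Re}\,H(-\frac dc)}$; and (2) for every $\begin{pmatrix}a&b\\c&d\end{pmatrix}\in SL_2(\mathbb{Z})$ the function $f\big(\frac{a\tau+b}{c\tau+d}\big)(c\tau+d)^{-k}$ is bounded near $i\infty$. *)

(* Defs.v *)
From HB Require Import structures.
From mathcomp Require Import all_boot all_order all_algebra all_fingroup.
From mathcomp Require Import all_classical all_reals all_analysis.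
From mathcomp Require Export complex.

Set Implicit Arguments.
Unset Strict Implicit.
Unset Printing Implicit Defensive.

Import Order.TTheory GRing.Theory Num.Theory.
Import numFieldNormedType.Exports.
Local Open Scope classical_set_scope.
Local Open Scope ring_scope.
Local Open Scope complex_scope.

Definition cexp (R : realType) (z : R[i]) : R[i] :=
  (expR (complex.Re z) * cos (complex.Im z)) +i* (expR (complex.Re z) * sin (complex.Im z)).

(* e(z) = exp (2 pi i z) *)
Definition e2pi (R : realType) (z : R[i]) : R[i] :=
  cexp ((2 * pi)%:C * 'i%C * z).

Definition cintegral (R : realType) (D : set R) (f : R -> R[i]) : R[i] :=
  (\int[lebesgue_measure]_(t in D) complex.Re (f t))
    +i* (\int[lebesgue_measure]_(t in D) complex.Im (f t)).

Section UnorderedSums.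
Context {R : realType} {T : choiceType}.

Definition abs_summable (D : set T) (a : T -> R[i]) : Prop :=
  summable D (fun x => (complex.Re `|a x|)%:E).

(* The value of an absolutely convergent sum over an unordered index set; it is
   meaningful only together with [abs_summable]. *)
Definition rsum (D : set T) (a : T -> R) : R :=
  fine (\esum_(x in D) (EFin \o a)^\+%E x)
  - fine (\esum_(x in D) (EFin \o a)^\-%E x).

Definition csum (D : set T) (a : T -> R[i]) : R[i] :=
  rsum D (fun x => complex.Re (a x)) +i* rsum D (fun x => complex.Im (a x)).

End UnorderedSums.

Definition SL2Z : set 'M[int]_2 := [set g | \det g = 1].

Definition Gamma0 (l : nat) : set 'M[int]_2 :=
  [set g | SL2Z g /\ (l %| g 1%R 0%R)%Z].

Definition Gamma1 (l : nat) : set 'M[int]_2 :=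
  [set g | [/\ Gamma0 l g, (g 0%R 0%R = 1 %[mod l])%Z & (g 1%R 1%R = 1 %[mod l])%Z]].

Section ModularForms.
Context {R : realType}.
Implicit Types (f h : R[i] -> R[i]) (g : 'M[int]_2) (tau : R[i]).

(* Functions on the upper half plane are represented by total functions on the
   complex numbers, of which only the values on [upper_half] are ever used. *)
Definition upper_half : set R[i] := [set tau | 0 < complex.Im tau].

Definition holomorphic_on_upper_half f : Prop :=
  forall tau, upper_half tau -> derivable (f : R[i]^o -> R[i]^o) tau 1.

Definition autfactor g tau : R[i] := (g 1 0)%:~R * tau + (g 1 1)%:~R.

Definition mobius g tau : R[i] :=
  ((g 0 0)%:~R * tau + (g 0 1)%:~R) / autfactor g tau.

Definition slash (k : nat) f g tau : R[i] :=
  f (mobius g tau) * autfactor g tau ^- k.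

(* [f] has an expansion sum_(n >= 1) a_n q^n with q = exp (2 pi i tau / l). *)
Definition cuspidal_q_expansion (l : nat) f : Prop :=
  exists2 a : nat -> R[i], a 0%N = 0 &
    forall tau, upper_half tau ->
      series (fun n => a n * e2pi (n%:R * tau / l%:R)) @ \oo
        --> (f tau : R[i]^o).

(* Every conjugate of Gamma0 l in SL2(Z) contains the translation by l, so that
   the width of each cusp divides l and q = exp (2 pi i tau / l) is a common
   uniformizer for all the functions [slash k h g]. *)
Definition cusp_form (k l : nat) h : Prop :=
  [/\ holomorphic_on_upper_half h,
      forall g tau, Gamma0 l g -> upper_half tau ->
        h (mobius g tau) = autfactor g tau ^+ k * h tau
    & forall g, SL2Z g -> cuspidal_q_expansion l (slash k h g)].

(* H(- d / c), the integral of h(s) ds from i oo to the cusp - d / c, along the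
   vertical line s = - d / c + i t; with t running from +oo to 0, ds = i dt.
   By convention H(- d / 0) = 0. *)
Definition cusp_integral h (c d : int) : R[i] :=
  if c == 0 then 0
  else - 'i%C * cintegral `]0, +oo[ (fun t => h ((- (d%:~R / c%:~R)) +i* t)).

Definition twist h (c d : int) : R[i] := e2pi (complex.Re (cusp_integral h c d))%:C.

Definition bounded_near_ioo f : Prop :=
  exists Y M : R, 0 < Y /\ forall tau, Y < complex.Im tau -> `|f tau| <= M%:C.

Definition twisted_modular_form (l : nat) h (k : nat) f : Prop :=
  [/\ holomorphic_on_upper_half f,
      forall g tau, Gamma1 l g -> upper_half tau ->
        f (mobius g tau) = autfactor g tau ^+ k * f tau
          * e2pi (- (complex.Re (cusp_integral h (g 1 0) (g 1 1)))%:C)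
    & forall g, SL2Z g -> bounded_near_ioo (slash k f g)].

Definition is_character (l : nat) (chi : {unit 'Z_l} -> R[i]) : Prop :=
  (forall u, chi u != 0) /\ {morph chi : u v / (u * v)%g >-> u * v}.

(* The class in (Z/l)^* of an integer d coprime to l. When l = 1 the type 'Z_l
   is Z/2, whose unit group is also trivial: the default value 1 then makes the
   class of every d the only element of the group. *)
Definition unit_class (l : nat) (d : int) : {unit 'Z_l} :=
  insubd (1%g : {unit 'Z_l}) (d%:~R : 'Z_l).

Definition Eis_hat_index (l : nat) : set (int * int) :=
  [set p | (l %| p.1)%Z /\ coprimez p.1 p.2].

Definition Eis_hat_term (l k : nat) (chi : {unit 'Z_l} -> R[i]) h tau
    (p : int * int) : R[i] :=
  (p.1%:~R * tau + p.2%:~R) ^- k * chi (unit_class l p.2) * twist h p.1 p.2.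

Definition Eis_hat (l k : nat) (chi : {unit 'Z_l} -> R[i]) h tau : R[i] :=
  csum (Eis_hat_index l) (Eis_hat_term k chi h tau).

Definition Eis_index (l : nat) : set (int * int) :=
  [set p | [/\ (l %| p.1)%Z, coprimez l p.2 & p != (0, 0)]].

Definition Eis_term (l k : nat) (i : 'I_l) h tau (p : int * int) : R[i] :=
  (p.1%:~R * tau + p.2%:~R) ^- k * e2pi (- (p.2%:~R * i%:R / l%:R))
    * twist h p.1 p.2.

Definition Eis (l k : nat) (i : 'I_l) h tau : R[i] :=
  csum (Eis_index l) (Eis_term k i h tau).

End ModularForms.

(* Main.v *)
Require Import Defs.
From mathcomp Require Import all_boot all_order all_algebra all_fingroup.
From mathcomp Require Import all_classical all_reals all_analysis.
From mathcomp Require Import measurable_realfun ring lra.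

(** Both series have the shape
      sum over the rows (m, n) in D of phi (n) e (Re H (- n / m)) (m tau + n) ^ (-k),
    where D is a set of nonzero rows that is stable under right multiplication by
    Gamma1 l, and phi is bounded and only depends on n modulo l. Replacing tau by
    g tau pulls out the factor (c tau + d) ^ k and replaces each row (m, n) by
    (m, n) g. The transformation law is therefore a reindexing of an absolutely
    convergent sum, once the cocycle identity
      H (- n' / m') = H (- n / m) + H (- d / c)   for (m', n') = (m, n) g
    is known; this is [cusp_integral_act], and [twisted_eis] draws the conclusion.

    The cocycle identity says that an integral between cusps splits at a third cusp
    and that h(s) ds is invariant under Gamma0 l. No contour has to be moved,
    because h and all its conjugates have q-expansions: integrating the expansion of
    h term by term gives a primitive F that vanishes at i oo
    ([q_expansion_primitive]). For every matrix A of determinant 1, the function slash 2 h A is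
    the derivative of F (A tau), and its expansion gives another primitive of it, so
    that F (A tau) tends to a constant C_A at i oo, uniformly in Re tau
    ([period_exists]). Modularity of h gives C_(g A) = C_g + C_A for g in Gamma0 l
    ([period_mul]), and the fundamental theorem of calculus on the vertical line
    from i oo to the cusp A oo identifies C_A with the integral of h along this line
    ([cusp_integral_period]).

    The analytic properties rest on one majorant. For k >= 3 and tau in a vertical
    strip bounded away from the real line, |m tau + n| ^ (-k) is at most a constant
    times ((|m| + 1) (|n| + 1)) ^ (-3/2), which is summable ([lattice_term_le]). The
    second-order Taylor remainders of the terms are bounded by the same majorant, so
    the sum can be differentiated term by term ([eis_cderiv]). The sum of all
    |m tau + n| ^ (-k) is invariant under the modular group up to the automorphy
    factor; translations bring Re tau into [0, 1), and this bounds the slashed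
    series near i oo ([eis_bounded]). *)

Set Implicit Arguments.
Unset Strict Implicit.
Unset Printing Implicit Defensive.

Import Order.TTheory GRing.Theory Num.Theory.
Import numFieldNormedType.Exports.
Import Normc.

Local Open Scope classical_set_scope.
Local Open Scope ring_scope.
Local Open Scope complex_scope.

(** * Absolute values and derivatives of complex functions *)

Section Norm.
Context {R : realType}.
Implicit Types z w : R[i].

Lemma normc_normr z : (normc z)%:C = `|z|.
Proof. by []. Qed.

Lemma normc_ge0 z : 0 <= normc z.
Proof. by case: z => a b /=; exact: sqrtr_ge0. Qed.

Lemma normc_gt0 z : (0 < normc z) = (z != 0).
Proof.
rewrite lt0r normc_ge0 andbT; congr negb; apply/eqP/eqP => [|->].
  exact: eq0_normc.
exact: normc0.
Qed.

Lemma normcX z n : normc (z ^+ n) = normc z ^+ n.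
Proof.
by elim: n => [|n IH]; rewrite ?expr0 ?normc1// !exprS normcM IH.
Qed.

Lemma normc_real (x : R) : normc x%:C = `|x|.
Proof. by rewrite /= expr0n/= addr0 sqrtr_sqr. Qed.

Lemma normc_int (n : int) : normc (n%:~R : R[i]) = `|n%:~R : R|.
Proof. by rewrite -normc_real rmorph_int. Qed.

Lemma normc_i : normc ('i%C : R[i]) = 1.
Proof. by rewrite /= expr0n expr1n add0r sqrtr1. Qed.

Lemma normc_nat (n : nat) : normc (n%:R : R[i]) = n%:R.
Proof. by rewrite -[n%:R]/(n%:Z%:~R) normc_int ger0_norm// ler0n. Qed.

Lemma Re_le_normc z : `|complex.Re z| <= normc z.
Proof.
case: z => a b /=; rewrite -sqrtr_sqr ler_sqrt ?lerDl ?sqr_ge0//.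
by rewrite addr_ge0 ?sqr_ge0.
Qed.

Lemma Im_le_normc z : `|complex.Im z| <= normc z.
Proof.
case: z => a b /=; rewrite -sqrtr_sqr ler_sqrt ?lerDr ?sqr_ge0//.
by rewrite addr_ge0 ?sqr_ge0.
Qed.

Lemma normcD z w : normc (z + w) <= normc z + normc w.
Proof. exact: (@le_normcD R). Qed.

Lemma normcN z : normc (- z) = normc z.
Proof. exact: (@complex.normcN R). Qed.

Lemma normc_le z : normc z <= `|complex.Re z| + `|complex.Im z|.
Proof.
rewrite {1}(complexE z); apply: le_trans (normcD _ _) _.
by rewrite normcM !normc_real normc_i mul1r.
Qed.

Lemma normc_distC z w : normc (z - w) = normc (w - z).
Proof. by rewrite -normcN opprB. Qed.

Lemma normcB_ge z w : normc z - normc w <= normc (z + w).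
Proof.
rewrite lerBlDr -{1}[z](addrK w); apply: le_trans (normcD _ _) _.
by rewrite normcN.
Qed.

Lemma normcB z w : normc (z - w) <= normc z + normc w.
Proof. by rewrite -(normcN w) normcD. Qed.

Lemma ReD z w : complex.Re (z + w) = complex.Re z + complex.Re w.
Proof. by case: z w => [a b] [c d]. Qed.
Lemma ImD z w : complex.Im (z + w) = complex.Im z + complex.Im w.
Proof. by case: z w => [a b] [c d]. Qed.
Lemma ReN z : complex.Re (- z) = - complex.Re z.
Proof. by case: z. Qed.
Lemma ImN z : complex.Im (- z) = - complex.Im z.
Proof. by case: z. Qed.

Lemma intC (n : int) : (n%:~R : R[i]) = (n%:~R : R)%:C.
Proof. by rewrite rmorph_int. Qed.
Lemma natC (n : nat) : (n%:R : R[i]) = (n%:R : R)%:C.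
Proof. by rewrite rmorph_nat. Qed.

End Norm.

Section ComplexDerivative.
Context {R : realType}.
Implicit Types (f g : R[i] -> R[i]) (z w D : R[i]).

(** Complex differentiability in Weierstrass form: the difference quotient never
    appears, so composition and termwise differentiation are plain estimates. *)
Definition cderiv f z D := forall e : R, 0 < e ->
  exists2 d : R, 0 < d & forall s, normc s < d ->
    normc (f (z + s) - f z - s * D) <= e * normc s.

(** The form in which derivatives arise below: every term of the series at hand
    has an explicit second-order Taylor remainder. *)
Lemma cderiv_quadratic f z D (K d : R) : 0 < d ->
  (forall s, normc s < d -> normc (f (z + s) - f z - s * D) <= K * normc s ^+ 2)
  -> cderiv f z D.
Proof.
move=> d0 H e e0; have K0 : 0 < `|K| + 1 by rewrite ltr_wpDl.
exists (Num.min d (e / (`|K| + 1))).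
  by rewrite lt_min d0 divr_gt0.
move=> s; rewrite lt_min => /andP[sd se]; apply: le_trans (H _ sd) _.
rewrite expr2 mulrA ler_wpM2r ?normc_ge0//.
apply: le_trans (_ : (`|K| + 1) * normc s <= _).
  by rewrite ler_wpM2r ?normc_ge0// (le_trans (ler_norm _))// lerDl.
by rewrite mulrC -ler_pdivlMr// ltW.
Qed.

Lemma cderivD f g z D E : cderiv f z D -> cderiv g z E ->
  cderiv (fun w => f w + g w) z (D + E).
Proof.
move=> df dg e e0; have e2 : 0 < e / 2 by rewrite divr_gt0.
have [d1 d10 H1] := df _ e2; have [d2 d20 H2] := dg _ e2.
exists (Num.min d1 d2); first by rewrite lt_min d10.
move=> s; rewrite lt_min => /andP[s1 s2].
have -> : f (z + s) + g (z + s) - (f z + g z) - s * (D + E) =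
  (f (z + s) - f z - s * D) + (g (z + s) - g z - s * E) by ring.
apply: le_trans (normcD _ _) _.
by rewrite (le_trans (lerD (H1 _ s1) (H2 _ s2)))// -mulrDl -splitr.
Qed.

Lemma cderivN f z D : cderiv f z D -> cderiv (fun w => - f w) z (- D).
Proof.
move=> df e e0; have [d d0 H] := df _ e0; exists d => // s /H.
by rewrite -normcN; congr (normc _ <= _); ring.
Qed.

Lemma cderiv_lip f z D : cderiv f z D ->
  exists2 d : R, 0 < d & forall s, normc s < d ->
    normc (f (z + s) - f z) <= (1 + normc D) * normc s.
Proof.
move=> /(_ 1 ltr01)[d d0 H]; exists d => // s /H H1.
rewrite -[f (z + s) - f z](subrK (s * D)); apply: le_trans (normcD _ _) _.
by rewrite mulrDl lerD// normcM mulrC.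
Qed.

Lemma cderiv_comp f g z D E : cderiv g z D -> cderiv f (g z) E ->
  cderiv (fun w => f (g w)) z (D * E).
Proof.
move=> dg df e e0.
have [d1 d10 L] := cderiv_lip dg.
set K := 1 + normc D in L.
have K0 : 0 < K by rewrite ltr_pwDl// normc_ge0.
have [d2 d20 H2] := df (e / 2 / K) (divr_gt0 (divr_gt0 e0 (ltr0Sn _ 1)) K0).
have M0 : 0 < 1 + normc E by rewrite ltr_pwDl// normc_ge0.
have [d3 d30 H3] := dg (e / 2 / (1 + normc E)) (divr_gt0 (divr_gt0 e0 (ltr0Sn _ 1)) M0).
exists (Num.min d1 (Num.min (d2 / K) d3)).
  by rewrite !lt_min d10 divr_gt0.
move=> s; rewrite !lt_min => /and3P[s1 s2 s3].
have := L _ s1; set u := g (z + s) - g z => Lu.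
have ud : normc u < d2.
  by rewrite (le_lt_trans Lu)// mulrC -ltr_pdivlMr.
have gu : g z + u = g (z + s) by rewrite /u addrC subrK.
have := H2 _ ud; rewrite gu => Hu.
have -> : f (g (z + s)) - f (g z) - s * (D * E) =
  (f (g (z + s)) - f (g z) - u * E) + (u - s * D) * E by ring.
have := H3 _ s3; rewrite -/u; move: u Lu ud gu Hu => u Lu ud gu Hu H3u.
apply: le_trans (normcD _ _) _; rewrite normcM [e in leRHS]splitr mulrDl lerD//.
  apply: le_trans Hu _; rewrite -mulrA ler_wpM2l ?divr_ge0 ?(ltW e0)//.
  by rewrite mulrC ler_pdivrMr// mulrC.
apply: le_trans (ler_wpM2r (normc_ge0 _) H3u) _.
rewrite [leLHS](_ : _ = e / 2 * normc s * (normc E / (1 + normc E))).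
  rewrite ler_piMr ?mulr_ge0 ?divr_ge0 ?(ltW e0) ?normc_ge0//.
  by rewrite ler_pdivrMr// mul1r lerDr.
by ring.
Qed.


Lemma cderiv_derivable f z D : cderiv f z D ->
  derivable (f : R[i]^o -> R[i]^o) z 1.
Proof.
move=> df; apply/cvg_ex; exists D; apply/cvgrPdist_le => /= e e0.
have eE : e = (complex.Re e)%:C.
  by move: e0; rewrite ltcE => /andP[/eqP/= + _]; case: (e) => a b /= ->.
have e0' : 0 < complex.Re e by move: e0; rewrite ltcE => /andP[].
have [d d0 H] := df _ e0'.
exists (d%:C); first by rewrite /= ltcR.
move=> s /=; rewrite sub0r normrN -normc_normr ltcR => sd s0.
have ns : 0 < normc s by rewrite normc_gt0.
rewrite -normc_normr eE lecR.
rewrite -[leLHS](mulrK (unitf_gt0 ns)) ler_pdivrMr//.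
rewrite -normcM (_ : _ * s = - (f (z + s) - f z - s * D)).
  by rewrite normcN; exact: H.
by rewrite /GRing.scale/= mulr1 [s + z]addrC; field.
Qed.

End ComplexDerivative.

Section RealPaths.
Context {R : realType}.
Implicit Types (f g : R[i] -> R[i]) (z v D : R[i]).

Lemma is_derive_eps (f : R -> R) (x D : R) :
  (forall e : R, 0 < e -> exists2 d : R, 0 < d &
    forall s, `|s| < d -> `|f (x + s) - f x - s * D| <= e * `|s|) ->
  is_derive x 1 f D.
Proof.
move=> H.
have cv : h^-1 *: ((f \o shift x) (h *: 1) - f x) @[h --> 0^'] --> (D : R).
  apply/cvgrPdist_le => /= e /H[d d0 Hd].
  exists d => // s /=; rewrite sub0r normrN => sd s0.
  have ns : 0 < `|s| by rewrite normr_gt0.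
  rewrite -[leLHS](mulrK (unitf_gt0 ns)) ler_pdivrMr//.
  rewrite -normrM (_ : _ * s = - (f (x + s) - f x - s * D)).
    by rewrite normrN; exact: Hd.
  by rewrite /GRing.scale/= mulr1 [s + x]addrC; field.
by split; [apply/cvg_ex; exists D|apply: cvg_lim].
Qed.

(** Restricting a complex function to a line turns complex derivatives into real
    ones; this gives access to the mean value theorem and to integrals. *)
Lemma is_derive_Re_path f z v D (t : R) : cderiv f (z + t%:C * v) D ->
  is_derive t 1 (fun s : R => complex.Re (f (z + s%:C * v))) (complex.Re (v * D)).
Proof.
move=> df; apply: is_derive_eps => e e0.
have v0 : 0 < 1 + normc v by rewrite ltr_pwDl// normc_ge0.
have [d d0 H] := df _ (divr_gt0 e0 v0).
exists (d / (1 + normc v)); first exact: divr_gt0.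
move=> s sd.
have nsv : normc (s%:C * v) <= `|s| * (1 + normc v).
  by rewrite normcM normc_real ler_wpM2l// lerDr.
have {}H : normc (f (z + t%:C * v + s%:C * v) - f (z + t%:C * v) - s%:C * v * D)
    <= e / (1 + normc v) * normc (s%:C * v).
  by apply: H; rewrite (le_lt_trans nsv)// -ltr_pdivlMr.
have -> : complex.Re (f (z + (t + s)%:C * v)) - complex.Re (f (z + t%:C * v))
   - s * complex.Re (v * D) =
   complex.Re (f (z + t%:C * v + s%:C * v) - f (z + t%:C * v) - s%:C * v * D).
  rewrite rmorphD/= mulrDl addrA !ReD !ReN; congr (_ - _ - _).
  by rewrite -mulrA; case: (v * D) => a b /=; rewrite mul0r subr0.
apply: le_trans (Re_le_normc _) _; apply: (le_trans H).
by rewrite mulrAC ler_pdivrMr// -mulrA ler_wpM2l// ltW.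
Qed.

Lemma cderivZ (c : R[i]) f z D : cderiv f z D ->
  cderiv (fun w => c * f w) z (c * D).
Proof.
move=> df; rewrite mulrC; apply: (@cderiv_comp _ ( *%R c) f) => //.
apply: (@cderiv_quadratic _ _ _ _ 0 1) => // s _.
by rewrite mulrDr [c * f z + _]addrC addrK mulrC subrr normc0 mul0r.
Qed.

Lemma is_derive_Im_path f z v D (t : R) : cderiv f (z + t%:C * v) D ->
  is_derive t 1 (fun s : R => complex.Im (f (z + s%:C * v))) (complex.Im (v * D)).
Proof.
move=> df.
have E w : complex.Im w = complex.Re (- 'i%C * w).
  by case: w => a b; rewrite /= mulN1r opprK oppr0 mul0r add0r.
rewrite (_ : (fun _ => _) = fun s : R => complex.Re (- 'i%C * f (z + s%:C * v))).
  rewrite E mulrCA.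
  exact: (is_derive_Re_path (cderivZ _ df)).
by apply/funext => s; rewrite E.
Qed.

Lemma ImZ (t : R) z : complex.Im (t%:C * z) = t * complex.Im z.
Proof. by case: z => a b /=; rewrite mul0r addr0. Qed.

Lemma ReZ (t : R) z : complex.Re (t%:C * z) = t * complex.Re z.
Proof. by case: z => a b /=; rewrite mul0r subr0. Qed.

(** The upper half plane is convex: the mean value theorem applies to the real and
    imaginary parts along the segment between two points. *)
Lemma cderiv0_cst f : (forall z, upper_half z -> cderiv f z 0) ->
  forall z w, upper_half z -> upper_half w -> f z = f w.
Proof.
move=> df z w uz uw.
have up (t : R) : t \in `[0, 1] -> upper_half (z + t%:C * (w - z)).
  rewrite in_itv/= => /andP[t0 t1]; rewrite /upper_half/= ImD ImZ ImD ImN.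
  rewrite /upper_half/= in uz uw.
  rewrite (_ : _ + _ = (1 - t) * complex.Im z + t * complex.Im w); last by ring.
  have [->|t0'] := eqVneq t 0; first by rewrite mul0r subr0 mul1r addr0.
  rewrite ltr_wpDl ?mulr_ge0 ?subr_ge0 ?(ltW uz)// mulr_gt0//.
  by rewrite lt0r t0'.
have s01 (t : R) : t \in `]0, 1[ -> t \in `[0, 1].
  by apply: subset_itv_oo_cc.
have key (L : R[i] -> R) : (forall t : R, t \in `[0, 1] ->
    is_derive t 1 (fun s : R => L (f (z + s%:C * (w - z)))) 0) -> L (f z) = L (f w).
  move=> dL; have [|_ _] := @MVT_segment R
    (fun s : R => L (f (z + s%:C * (w - z)))) (fun=> 0) 0 1 ler01
    (fun t t01 => dL t (s01 t t01)).
    by apply: derivable_within_continuous => t /dL[].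
  move=> E; have /eqP : L (f (z + 1%:C * (w - z))) - L (f (z + 0%:C * (w - z))) = 0.
    by rewrite E /= mul0r.
  rewrite subr_eq0 => /eqP.
  have -> : z + 1%:C * (w - z) = w by rewrite rmorph1 mul1r addrC subrK.
  move->; congr (L (f _)).
  by rewrite rmorph0 mul0r addr0.
case Ez : (f z) (key (@complex.Re R)) (key (@complex.Im R)) => [a b].
case Ew : (f w) => [c d] /= kR kI; congr (_ +i* _).
- apply: kR => t /up ut; rewrite -[X in is_derive _ _ _ X]/(complex.Re (0 : R[i])).
  by rewrite -(mulr0 (w - z)); apply: is_derive_Re_path; exact: df.
- apply: kI => t /up ut; rewrite -[X in is_derive _ _ _ X]/(complex.Im (0 : R[i])).
  by rewrite -(mulr0 (w - z)); apply: is_derive_Im_path; exact: df.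
Qed.

End RealPaths.

(** * Unordered sums of real families *)

Section RealSums.
Context {R : realType} {T : choiceType}.
Implicit Types (D : set T) (a b p q : T -> R).

Definition rsummable D a : Prop := summable D (EFin \o a).

Lemma rsummable_le D a b : rsummable D b -> (forall x, D x -> `|a x| <= b x) -> rsummable D a.
Proof.
move=> sb ab; apply: le_lt_trans sb; apply: le_esum => x /ab.
by rewrite /= lee_fin => /le_trans; apply; exact: ler_norm.
Qed.

Lemma rsummableD D a b : rsummable D a -> rsummable D b -> rsummable D (fun x => a x + b x).
Proof. by move=> sa sb; exact: (summableD sa sb). Qed.

Lemma fin_esum D p : rsummable D p -> (forall x, D x -> 0 <= p x) ->
  \esum_(x in D) (p x)%:E \is a fin_num.
Proof.
move=> sp p0; move: sp; rewrite /rsummable summableE; congr (_ \is a fin_num).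
by apply: eq_esum => x Dx /=; rewrite ger0_norm ?p0.
Qed.

Definition nnsum D p : R := fine (\esum_(x in D) (p x)%:E).

Lemma nnsum_ge0 D p : (forall x, D x -> 0 <= p x) -> 0 <= nnsum D p.
Proof. by move=> p0; apply/fine_ge0/esum_ge0 => x /p0. Qed.

Lemma le_nnsum D p q : rsummable D q -> (forall x, D x -> 0 <= p x <= q x) ->
  nnsum D p <= nnsum D q.
Proof.
move=> sq pq.
have q0 x : D x -> 0 <= q x by move=> /pq/andP[]; exact: le_trans.
have p0 x : D x -> 0 <= p x by move=> /pq/andP[].
have sp : rsummable D p.
  by apply: (rsummable_le sq) => x Dx; rewrite ger0_norm ?p0//; case/andP: (pq _ Dx).
apply: fine_le; [exact: fin_esum|exact: fin_esum|].
by apply: le_esum => x /pq/andP[_]; rewrite lee_fin.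
Qed.

Lemma nnsumD D p q : rsummable D p -> rsummable D q -> (forall x, D x -> 0 <= p x) ->
  (forall x, D x -> 0 <= q x) -> nnsum D (fun x => p x + q x) = nnsum D p + nnsum D q.
Proof.
move=> sp sq p0 q0; rewrite /nnsum -fineD ?fin_esum// -esumD//.
Qed.

Lemma nnsum_le D p (M : R) : 0 <= M ->
  (\esum_(x in D) (p x)%:E <= M%:E)%E -> (forall x, D x -> 0 <= p x) ->
  nnsum D p <= M.
Proof.
move=> M0 pM p0; rewrite -[leRHS]/(fine M%:E); apply: fine_le => //.
by rewrite ge0_fin_numE ?esum_ge0// ?(le_lt_trans pM) ?ltry// => x /p0.
Qed.

Lemma esumZ_le D p (c : R) : 0 <= c -> (forall x, D x -> 0 <= p x) ->
  (\esum_(x in D) (c * p x)%:E <= c%:E * \esum_(x in D) (p x)%:E)%E.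
Proof.
move=> c0 p0; apply: ge_ereal_sup => _ [X [finX XD] <-].
apply: le_trans (_ : c%:E * (\sum_(x \in X) (p x)%:E) <= _)%E.
  rewrite !fsbig_finite//= !sumEFin -EFinM lee_fin mulr_sumr//.
by rewrite lee_wpmul2l ?lee_fin//; apply: ereal_sup_ubound; exists X.
Qed.

Lemma rsummableZ D a (c : R) : rsummable D a -> rsummable D (fun x => c * a x).
Proof.
move=> sa; rewrite /rsummable/summable.
under eq_esum do rewrite /= normrM.
apply: le_lt_trans (esumZ_le _ _) _ => //.
by rewrite muleC; move: sa; rewrite /rsummable summableE => /fineK <-; rewrite -EFinM ltry.
Qed.

Lemma nnsumZ D p (c : R) : 0 <= c -> rsummable D p -> (forall x, D x -> 0 <= p x) ->
  nnsum D (fun x => c * p x) = c * nnsum D p.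
Proof.
move=> c0 sp p0; have [->|cn0] := eqVneq c 0.
  rewrite mul0r /nnsum; under eq_esum do rewrite mul0r; by rewrite esum1.
have cp0 x : D x -> 0 <= c * p x by move=> /p0; exact: mulr_ge0.
have scp := rsummableZ c sp.
have le_ : forall (c : R) p, 0 <= c -> rsummable D p -> (forall x, D x -> 0 <= p x) ->
    nnsum D (fun x => c * p x) <= c * nnsum D p.
  move=> c' p' c'0 sp' p'0.
  rewrite -lee_fin EFinM /nnsum !fineK ?fin_esum//; first exact: esumZ_le.
    exact: rsummableZ.
  by move=> x /p'0; exact: mulr_ge0.
apply/eqP; rewrite eq_le le_//= mulrC -ler_pdivlMr ?lt0r ?cn0//.
rewrite mulrC; apply: le_trans (le_ _ _ _ scp cp0); last by rewrite invr_ge0.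
by rewrite le_eqVlt; apply/orP; left; apply/eqP; congr nnsum; apply/funext => x; rewrite mulKf.
Qed.

Lemma eq_nnsum D p q : (forall x, D x -> p x = q x) -> nnsum D p = nnsum D q.
Proof. by move=> pq; congr fine; apply: eq_esum => x /pq ->. Qed.

(** A signed sum does not depend on how the family is split into a difference of
    nonnegative summable families; linearity of signed sums reduces to this. *)
Lemma rsumE D a p q : rsummable D p -> rsummable D q -> (forall x, D x -> 0 <= p x) ->
  (forall x, D x -> 0 <= q x) -> (forall x, D x -> a x = p x - q x) ->
  rsum D a = nnsum D p - nnsum D q.
Proof.
move=> sp sq p0 q0 apq.
have := esumB sp sq p0 q0.
have e1 : \esum_(i in D) ((EFin \o p) \- (EFin \o q))^\+%E i =
          \esum_(i in D) (EFin \o a)^\+%E i.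
  by apply: eq_esum => x Dx; rewrite !funeposE /= apq.
have e2 : \esum_(i in D) ((EFin \o p) \- (EFin \o q))^\-%E i =
          \esum_(i in D) (EFin \o a)^\-%E i.
  by apply: eq_esum => x Dx; rewrite !funenegE /= apq.
rewrite e1 e2 => E.
have sa : summable D (EFin \o a).
  apply: (rsummable_le (rsummableD sp sq)) => x Dx.
  rewrite apq//; apply: le_trans (ler_normB _ _) _.
  by rewrite !ger0_norm ?p0 ?q0.
have fp : \esum_(i in D) (EFin \o a)^\+%E i \is a fin_num.
  by have := summable_funepos sa; rewrite summableE; congr (_ \is a fin_num);
    apply: eq_esum => x Dx; rewrite gee0_abs.
have fn : \esum_(i in D) (EFin \o a)^\-%E i \is a fin_num.
  by have := summable_funeneg sa; rewrite summableE; congr (_ \is a fin_num);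
    apply: eq_esum => x Dx; rewrite gee0_abs.
by rewrite /rsum -fineB// E fineB// fin_esum.
Qed.

Lemma rsummable_subset (A B : set T) (u : T -> R) : A `<=` B ->
  rsummable B u -> rsummable A u.
Proof.
move=> AB; rewrite /rsummable/summable; apply: le_lt_trans.
rewrite -(setIidl AB) esum_mkcondr.
rewrite [leRHS](esumID A)//.
rewrite (_ : B `&` A = A); last exact: setIidr.
apply: le_trans (leeDl _ _); last by apply: esum_ge0 => i _; exact: abse_ge0.
by apply: le_esum => i Ai; rewrite ifT// inE; exact: AB.
Qed.

Lemma nnsum_subset (A B : set T) (u : T -> R) : A `<=` B ->
  rsummable B u -> (forall x, 0 <= u x) -> nnsum A u <= nnsum B u.
Proof.
move=> AB sB u0; apply: nnsum_le; first by apply: nnsum_ge0.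
  rewrite /nnsum fineK ?fin_esum// [leRHS](esumID A) => [|x _]; last by rewrite lee_fin.
  rewrite (_ : B `&` A = A); last exact: setIidr.
  by apply: leeDl; apply: esum_ge0 => x _; rewrite lee_fin.
by [].
Qed.

Definition pos a x := Num.max (a x) 0.
Definition neg a x := Num.max (- a x) 0.

Lemma pos_ge0 a x : 0 <= pos a x. Proof. by rewrite le_max lexx orbT. Qed.
Lemma neg_ge0 a x : 0 <= neg a x. Proof. by rewrite le_max lexx orbT. Qed.
Lemma pos_neg a x : a x = pos a x - neg a x.
Proof.
rewrite /pos /neg; case/orP: (le_total 0 (a x)) => h.
  by rewrite max_l// max_r ?oppr_le0// subr0.
by rewrite max_r// max_l ?oppr_ge0// sub0r opprK.
Qed.
Lemma pos_neg_abs a x : `|a x| = pos a x + neg a x.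
Proof.
rewrite /pos /neg; case/orP: (le_total 0 (a x)) => h.
  by rewrite max_l// max_r ?oppr_le0// addr0 ger0_norm.
by rewrite max_r// max_l ?oppr_ge0// add0r ler0_norm.
Qed.
Lemma rsummable_norm D a : rsummable D a -> rsummable D (fun x => `|a x|).
Proof.
by rewrite /rsummable/summable => sa; under eq_esum do rewrite /= normr_id.
Qed.
Lemma rsummable_pos D a : rsummable D a -> rsummable D (pos a).
Proof.
move=> /rsummable_norm sa; apply: (rsummable_le sa) => x _.
by rewrite [leRHS]pos_neg_abs ger0_norm ?pos_ge0// lerDl neg_ge0.
Qed.
Lemma rsummable_neg D a : rsummable D a -> rsummable D (neg a).
Proof.
move=> /rsummable_norm sa; apply: (rsummable_le sa) => x _.
by rewrite [leRHS]pos_neg_abs ger0_norm ?neg_ge0// lerDr pos_ge0.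
Qed.
Hint Resolve pos_ge0 neg_ge0 rsummable_pos rsummable_neg rsummableD : core.

Lemma rsum_pn D a : rsummable D a -> rsum D a = nnsum D (pos a) - nnsum D (neg a).
Proof.
by move=> sa; apply: rsumE; auto => x _; rewrite ?pos_ge0 ?neg_ge0// -pos_neg.
Qed.

Lemma rsumD D a b : rsummable D a -> rsummable D b ->
  rsum D (fun x => a x + b x) = rsum D a + rsum D b.
Proof.
move=> sa sb; rewrite (rsum_pn sa) (rsum_pn sb).
rewrite (@rsumE D _ (fun x => pos a x + pos b x) (fun x => neg a x + neg b x)); auto.
- by rewrite !nnsumD; auto; ring.
- by move=> *; rewrite addr_ge0.
- by move=> *; rewrite addr_ge0.
- by move=> x _; rewrite {1}(pos_neg a) {1}(pos_neg b); ring.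
Qed.

Lemma rsumN D a : rsummable D a -> rsum D (fun x => - a x) = - rsum D a.
Proof.
move=> sa; rewrite (rsum_pn sa) opprB; apply: rsumE; auto.
by move=> x _; rewrite {1}(pos_neg a) opprB.
Qed.

Lemma rsummableN D a : rsummable D a -> rsummable D (fun x => - a x).
Proof.
move=> sa; rewrite /rsummable/summable; apply: le_lt_trans sa; apply: le_esum => x _.
by rewrite /= normrN.
Qed.

Lemma rsumZ D a (c : R) : rsummable D a -> rsum D (fun x => c * a x) = c * rsum D a.
Proof.
move=> sa; wlog c0 : c / 0 <= c.
  move=> H; have [/H//|/ltW c0] := leP 0 c.
  rewrite -[c]opprK mulNr -H ?oppr_ge0// -rsumN; last exact: rsummableZ.
  by congr rsum; apply/funext => x; rewrite mulNr.
rewrite (rsum_pn sa) mulrBr -!nnsumZ; auto.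
apply: rsumE; do ?[by apply: rsummableZ; auto|by move=> *; rewrite mulr_ge0].
by move=> x _; rewrite -mulrBr -pos_neg.
Qed.

Lemma eq_rsum D a b : (forall x, D x -> a x = b x) -> rsum D a = rsum D b.
Proof.
move=> ab; congr (fine _ - fine _); apply: eq_esum => x Dx.
  by rewrite !funeposE /= ab.
by rewrite !funenegE /= ab.
Qed.

Lemma rsum_abs D a p : rsummable D p -> (forall x, D x -> `|a x| <= p x) ->
  `|rsum D a| <= nnsum D p.
Proof.
move=> sp ap; have sa := rsummable_le sp ap.
rewrite rsum_pn//; apply: le_trans (ler_normB _ _) _.
rewrite !ger0_norm ?nnsum_ge0// -nnsumD; auto.
by apply: le_nnsum => // x Dx; rewrite -pos_neg_abs ap ?normr_ge0.
Qed.

End RealSums.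

(** * Unordered sums of complex families *)

Section ComplexSums.
Context {R : realType} {T : choiceType}.
Implicit Types (D : set T) (a b : T -> R[i]) (p : T -> R).

Definition csummable D a := rsummable D (fun x => normc (a x)).

Lemma csummable_le D a p : rsummable D p -> (forall x, D x -> normc (a x) <= p x) ->
  csummable D a.
Proof.
by move=> sp ap; apply: (rsummable_le sp) => x Dx; rewrite ger0_norm ?normc_ge0 ?ap.
Qed.

Lemma csummable_Re D a : csummable D a -> rsummable D (fun x => complex.Re (a x)).
Proof. by move=> sa; apply: (rsummable_le sa) => x _; exact: Re_le_normc. Qed.
Lemma csummable_Im D a : csummable D a -> rsummable D (fun x => complex.Im (a x)).
Proof. by move=> sa; apply: (rsummable_le sa) => x _; exact: Im_le_normc. Qed.
Hint Resolve csummable_Re csummable_Im rsummableN rsummableZ rsummableD : core.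

Lemma csummableD D a b : csummable D a -> csummable D b -> csummable D (fun x => a x + b x).
Proof. by move=> sa sb; apply: (csummable_le (rsummableD sa sb)) => x _; exact: normcD. Qed.

Lemma csummableZ D a (c : R[i]) : csummable D a -> csummable D (fun x => c * a x).
Proof.
by move=> sa; apply: (csummable_le (rsummableZ (normc c) sa)) => x _; rewrite normcM.
Qed.

Lemma csummableN D a : csummable D a -> csummable D (fun x => - a x).
Proof. by move=> sa; apply: (csummable_le sa) => x _; rewrite normcN. Qed.

Lemma csumD D a b : csummable D a -> csummable D b ->
  csum D (fun x => a x + b x) = csum D a + csum D b.
Proof.
move=> sa sb; rewrite /csum.
under eq_rsum do rewrite ReD.
under [in X in _ +i* X]eq_rsum do rewrite ImD.
by rewrite !rsumD; auto.
Qed.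

Lemma csumZ D a (c : R[i]) : csummable D a ->
  csum D (fun x => c * a x) = c * csum D a.
Proof.
move=> sa; rewrite /csum; case: c => u v.
have -> : (u +i* v) * (rsum D (fun x => complex.Re (a x)) +i*
    rsum D (fun x => complex.Im (a x))) =
  (u * rsum D (fun x => complex.Re (a x)) - v * rsum D (fun x => complex.Im (a x))) +i*
  (u * rsum D (fun x => complex.Im (a x)) + v * rsum D (fun x => complex.Re (a x))).
  by [].
rewrite -!rsumZ; auto.
rewrite -rsumN -?rsumD; auto.
by congr (_ +i* _); apply: eq_rsum => x _; case: (a x).
Qed.

Lemma csumN D a : csummable D a -> csum D (fun x => - a x) = - csum D a.
Proof.
move=> sa; rewrite -[in RHS]mulN1r -csumZ//.
by congr csum; apply/funext => x; rewrite mulN1r.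
Qed.

Lemma csumB D a b : csummable D a -> csummable D b ->
  csum D (fun x => a x - b x) = csum D a - csum D b.
Proof. by move=> sa sb; rewrite csumD ?csumN//; exact: csummableN. Qed.

Lemma eq_csum D a b : (forall x, D x -> a x = b x) -> csum D a = csum D b.
Proof. by move=> ab; congr (_ +i* _); apply: eq_rsum => x /ab ->. Qed.

(** The factor 2 comes from bounding real and imaginary parts separately; only
    finiteness of such bounds matters below. *)
Lemma csum_norm D a p : rsummable D p -> (forall x, D x -> normc (a x) <= p x) ->
  normc (csum D a) <= 2 * nnsum D p.
Proof.
move=> sp ap; apply: le_trans (normc_le _) _; rewrite mulr_natl mulr2n lerD//=.
  by apply: rsum_abs => // x /ap; apply/le_trans/Re_le_normc.
by apply: rsum_abs => // x /ap; apply/le_trans/Im_le_normc.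
Qed.

Lemma rsum_reindex D (e : T -> T) (u : T -> R) : set_bij D D e ->
  rsum D (fun x => u (e x)) = rsum D u.
Proof.
move=> be; rewrite /rsum; congr (fine _ - fine _).
  by rewrite [RHS](reindex_esum D D e) //; apply: eq_esum => x _; rewrite !funeposE.
by rewrite [RHS](reindex_esum D D e) //; apply: eq_esum => x _; rewrite !funenegE.
Qed.

Lemma csum_reindex D (e : T -> T) a : set_bij D D e ->
  csum D (fun x => a (e x)) = csum D a.
Proof.
move=> be; rewrite /csum -(rsum_reindex (fun x => complex.Re (a x)) be).
by rewrite -(rsum_reindex (fun x => complex.Im (a x)) be).
Qed.

(** Termwise differentiation: if the second-order remainders of the terms are
    bounded by a summable family times the square of the increment, then so is the
    remainder of the sum. *)
Lemma csum_cderiv D (f : T -> R[i] -> R[i]) (f' : T -> R[i]) (B : T -> R) (z : R[i])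
    (d : R) : 0 < d -> rsummable D B -> csummable D f' ->
  (forall s, normc s < d -> csummable D (fun x => f x (z + s))) ->
  (forall s, normc s < d -> forall x, D x ->
     normc (f x (z + s) - f x z - s * f' x) <= B x * normc s ^+ 2) ->
  cderiv (fun w => csum D (fun x => f x w)) z (csum D f').
Proof.
move=> d0 sB sf' sf H.
have sz : csummable D (fun x => f x z) by rewrite -[z]addr0; apply: sf; rewrite normc0.
apply: (@cderiv_quadratic _ _ _ _ (2 * nnsum D (fun x => `|B x|)) d) => // s sd.
rewrite -csumB//; last exact: sf.
rewrite -csumZ// -csumB; last exact: csummableZ; last first.
  by apply: csummableD; [exact: sf|exact: csummableN].
apply: le_trans (csum_norm (p := fun x => normc s ^+ 2 * `|B x|) _ _) _.
- exact/rsummableZ/rsummable_norm.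
- move=> x Dx; apply: le_trans (H _ sd _ Dx) _.
  by rewrite mulrC ler_wpM2l ?exprn_ge0 ?normc_ge0 ?ler_norm.
- rewrite nnsumZ ?exprn_ge0 ?normc_ge0//; last exact: rsummable_norm.
  by rewrite mulrCA mulrC.
Qed.

End ComplexSums.

Section SequenceSums.
Context {R : realType}.

Lemma rsum_series (u : nat -> R) : rsummable setT u -> series u @ \oo --> rsum setT u.
Proof.
move=> su; rewrite rsum_pn//.
have key (p : nat -> R) : rsummable setT p -> (forall n, 0 <= p n) ->
    series p @ \oo --> nnsum setT p.
  move=> sp p0; have h := @summable_nneseries_lim R xpredT (EFin \o p).
  have c := @summable_cvg R xpredT (EFin \o p).
  have ET : (fun n : nat => is_true (xpredT n)) = setT by apply/seteqP; split.
  rewrite /= ET in h c.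
  rewrite /nnsum -nneseries_esumT//= ?h//; last by move=> n _; rewrite lee_fin.
    by apply: c => // n _; rewrite lee_fin.
have -> : series u = series (pos u) - series (neg u).
  apply/funext => n; transitivity (\sum_(0 <= i < n) (pos u i - neg u i)).
    by apply: eq_bigr => i _; rewrite -pos_neg.
  exact: sumrB.
by apply: cvgB; apply: key => *; rewrite ?pos_ge0 ?neg_ge0//;
  [exact: rsummable_pos|exact: rsummable_neg].
Qed.

Lemma rsummable_series_le (p : nat -> R) (M : R) : (forall n, 0 <= p n) ->
  (forall n, series p n <= M) -> rsummable setT p.
Proof.
move=> p0 pM; have E : (\esum_(x in [set: nat]) (p x)%:E <= M%:E)%E.
  rewrite -nneseries_esumT; last by move=> n; rewrite lee_fin.
  apply: lime_le; first by apply: is_cvg_nneseries => n _ _; rewrite lee_fin.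
  by apply: nearW => n; rewrite sumEFin lee_fin; exact: pM.
rewrite /rsummable/summable.
under eq_esum do rewrite /= ger0_norm//.
by rewrite (le_lt_trans E)// ltry.
Qed.

Lemma rsummable_geometric (r : R) : 0 <= r < 1 -> rsummable setT (fun n => r ^+ n).
Proof.
move=> /andP[r0 r1]; apply: (@rsummable_series_le _ (1 - r)^-1) => [n|n].
  exact: exprn_ge0.
have r1' : 0 < 1 - r by rewrite subr_gt0.
rewrite -[leRHS]mul1r ler_pdivlMr// /series/=.
have -> : (\sum_(0 <= k < n) r ^+ k) * (1 - r) = 1 - r ^+ n.
  elim: n => [|n IH]; first by rewrite big_geq// mul0r expr0 subrr.
  by rewrite big_nat_recr//= mulrDl IH exprS; ring.
by rewrite lerBlDr lerDl exprn_ge0.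
Qed.

(** Cuspidal expansions are given as limits of partial sums; absolute summability
    makes the unordered sum agree with that limit. *)
Lemma csum_series (a : nat -> R[i]) (v : R[i]) : csummable setT a ->
  series a @ \oo --> (v : R[i]^o) -> csum setT a = v.
Proof.
move=> sa av.
have eps (L : R[i] -> R) : (forall z, `|L z| <= normc z) ->
    (forall z w, L (z + w) = L z + L w) ->
    (forall z, L (- z) = - L z) -> 
    rsummable setT (fun n => L (a n)) -> rsum setT (fun n => L (a n)) = L v.
  move=> Ln LD LN sL.
  have L0 : L 0 = 0 by have := LD 0 0; rewrite addr0 => /eqP; rewrite -subr_eq subrr => /eqP.
  suff cv : series (fun n => L (a n)) @ \oo --> L v.
    by have := cvg_unique _ (rsum_series sL) cv; apply.
  apply/cvgrPdist_lt => e e0.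
  have : \forall n \near \oo, `|v - series a n| < e%:C.
    by apply: (proj1 (@cvgrPdist_lt _ R[i]^o _ _ _ _ v) av); rewrite ltcR.
  apply: filterS => n; rewrite -normc_normr ltcR; apply: le_lt_trans.
  have -> : series (fun n => L (a n)) n = L (series a n).
    rewrite /series/=; elim: n => [|n IH]; first by rewrite !big_geq ?L0.
    by rewrite !big_nat_recr//= IH LD.
  by rewrite -LN -LD; exact: Ln.
rewrite [RHS](_ : v = complex.Re v +i* complex.Im v); last by case: (v).
congr (_ +i* _).
- by apply: eps; [exact: Re_le_normc|exact: ReD|exact: ReN|exact: csummable_Re].
- by apply: eps; [exact: Im_le_normc|exact: ImD|exact: ImN|exact: csummable_Im].
Qed.

End SequenceSums.

(** * The complex exponential *)

Section RealTaylor.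
Context {R : realType}.
Implicit Types x y : R.

Lemma expRB1_le x : `|expR x - 1| <= `|x| * expR `|x|.
Proof.
have e1 : 1 <= expR `|x| by rewrite -expR0 ler_expR.
have h1 := expR_ge1Dx x.
have h2 : expR x - 1 <= x * expR x.
  have := ler_wpM2r (expR_ge0 x) (expR_ge1Dx (- x)).
  by rewrite -expRD addNr expR0; lra.
have [x0|x0] := leP 0 x.
  by rewrite (ger0_norm x0) ger0_norm ?subr_ge0// -expR0 ler_expR.
have : expR x <= 1 by rewrite -expR0 ler_expR ltW.
move=> h; rewrite [`|expR x - 1|]ler0_norm ?subr_le0//.
apply: le_trans (_ : `|x| * 1 <= _); last by rewrite ler_wpM2l.
by rewrite mulr1 ltr0_norm//; lra.
Qed.

Lemma expR_taylor1 x : `|expR x - 1 - x| <= x ^+ 2 * expR `|x|.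
Proof.
have h1 := expR_ge1Dx x.
have h2 : expR x - 1 <= x * expR x.
  have := ler_wpM2r (expR_ge0 x) (expR_ge1Dx (- x)).
  by rewrite -expRD addNr expR0; lra.
rewrite ger0_norm; last by lra.
apply: le_trans (_ : x * (expR x - 1) <= _); first by lra.
apply: le_trans (ler_norm _) _; rewrite normrM -(real_normK (num_real x)) expr2 -mulrA.
by rewrite ler_wpM2l// expRB1_le.
Qed.

(** The mean value inequality at 0, for both signs of the argument. *)
Lemma norm_le_derive_bound (f f' : R -> R) (M y : R) : f 0 = 0 ->
  (forall x, is_derive x 1 f (f' x)) ->
  (forall x, `|x| <= `|y| -> `|f' x| <= M) -> `|f y| <= M * `|y|.
Proof.
move=> f0 df H.
have cf a b : {within `[a, b], continuous f}.
  by apply: derivable_within_continuous => x _; have [] := df x.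
have [y0|/ltW y0] := leP 0 y.
  have [c] := MVT_segment y0 (fun x _ => df x) (cf _ _).
  rewrite in_itv/= f0 !subr0 => /andP[c0 cy] ->; rewrite normrM ler_wpM2r//.
  by apply: H; rewrite !ger0_norm.
have [c] := MVT_segment y0 (fun x _ => df x) (cf _ _).
rewrite in_itv/= f0 !sub0r => /andP[yc c0] E; rewrite -normrN E normrM normrN ler_wpM2r//.
by apply: H; rewrite !ler0_norm// lerN2.
Qed.

Lemma cosB1_le x : `|cos x - 1| <= `|x|.
Proof.
rewrite -[leRHS]mul1r; apply: (@norm_le_derive_bound (fun x => cos x - 1) (fun x => - sin x)).
- by rewrite cos0 subrr.
- by move=> y; rewrite -[- sin y]subr0; exact: (@is_deriveB _ _ _ cos (cst 1)).
- by move=> y _; rewrite normrN sin_max.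
Qed.

Lemma sin_le_norm x : `|sin x| <= `|x|.
Proof.
rewrite -[leRHS]mul1r; apply: (@norm_le_derive_bound sin cos).
- by rewrite sin0.
- by move=> y _; rewrite cos_max.
Qed.

Lemma cos_taylor1 x : `|cos x - 1| <= x ^+ 2.
Proof.
rewrite -(real_normK (num_real x)) expr2.
apply: (@norm_le_derive_bound (fun x => cos x - 1) (fun x => - sin x)).
- by rewrite cos0 subrr.
- by move=> y; rewrite -[- sin y]subr0; exact: (@is_deriveB _ _ _ cos (cst 1)).
- by move=> y; rewrite normrN; apply: le_trans; exact: sin_le_norm.
Qed.

Lemma sin_taylor1 x : `|sin x - x| <= x ^+ 2.
Proof.
rewrite -(real_normK (num_real x)) expr2.
apply: (@norm_le_derive_bound (fun x => sin x - x) (fun x => cos x - 1)).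
- by rewrite sin0 subrr.
- by move=> y; apply: le_trans; exact: cosB1_le.
Qed.

(** The cube of the inequality 1 + x / 3 <= expR (x / 3). *)
Lemma expR_cube_ge x : 0 <= x -> x ^+ 3 / 27 <= expR x.
Proof.
move=> x0; rewrite (_ : expR x = expR (x / 3) ^+ 3); last first.
  by rewrite -expRM_natl; congr expR; field.
rewrite (_ : _ / _ = (x / 3) ^+ 3); last by field.
rewrite lerXn2r ?nnegrE ?expR_ge0 ?divr_ge0//.
by apply: le_trans (expR_ge1Dx _); rewrite lerDr.
Qed.

End RealTaylor.

Section ComplexExponential.
Context {R : realType}.
Implicit Types z w : R[i].

Lemma cexpD z w : cexp (z + w) = cexp z * cexp w.
Proof.
case: z w => [a b] [c d]; rewrite /cexp/= expRD cosD sinD.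
by congr (_ +i* _); ring.
Qed.

Lemma normc_cexp z : normc (cexp z) = expR (complex.Re z).
Proof.
by rewrite /= !exprMn -mulrDr cos2Dsin2 mulr1 sqrtr_sqr ger0_norm ?expR_ge0.
Qed.

(** Real and imaginary parts of the remainder split into the remainders of the real
    exponential, the sine and the cosine. *)
Lemma cexp_taylor1 z : normc (cexp z - 1 - z) <= 4 * normc z ^+ 2 * expR (normc z).
Proof.
have := Re_le_normc z; have := Im_le_normc z; set N := normc z => hy hx.
have N0 : 0 <= N := normc_ge0 z.
apply: le_trans (normc_le _) _; rewrite !ReD !ReN !ImD !ImN /=.
move: (complex.Re z) (complex.Im z) hx hy N0; move: {z}N => N x y hx hy N0.
have sq (t : R) : `|t| <= N -> t ^+ 2 <= N ^+ 2.
  by move=> tN; rewrite -(real_normK (num_real t)) lerXn2r ?nnegrE.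
have Ex (t : R) : `|t| <= N -> expR `|t| <= expR N by rewrite ler_expR.
have Ex' : expR x <= expR N by apply: le_trans (Ex _ hx); rewrite ler_expR ler_norm.
have E0 := expR_ge0 N; have sx := sq _ hx; have sy := sq _ hy.
have NE0 : 0 <= N ^+ 2 * expR N by rewrite mulr_ge0 ?sqr_ge0.
rewrite (_ : 4 * N ^+ 2 * expR N = (N ^+ 2 * expR N + N ^+ 2 * expR N) +
   (N ^+ 2 * expR N + N ^+ 2 * expR N)); last by ring.
rewrite lerD//.
  rewrite (_ : _ - x = (expR x - 1 - x) + expR x * (cos y - 1)); last by ring.
  apply: le_trans (ler_normD _ _) _; rewrite lerD//.
    by apply: le_trans (expR_taylor1 _) _; rewrite ler_pM ?sqr_ge0 ?expR_ge0 ?Ex.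
  rewrite normrM mulrC ler_pM// ?(le_trans (cos_taylor1 _))//.
  by rewrite ger0_norm ?expR_ge0.
rewrite oppr0 addr0 (_ : _ - y = expR x * (sin y - y) + (expR x - 1) * y); last by ring.
apply: le_trans (ler_normD _ _) _; rewrite lerD//.
  rewrite normrM mulrC ler_pM// ?(le_trans (sin_taylor1 _))//.
  by rewrite ger0_norm ?expR_ge0.
rewrite normrM expr2 -mulrA [N * expR N]mulrC mulrA ler_pM//.
apply: le_trans (expRB1_le _) _.
by rewrite ler_pM// ?expR_ge0// Ex.
Qed.

Lemma e2piD z w : e2pi (z + w) = e2pi z * e2pi w.
Proof. by rewrite /e2pi mulrDr cexpD. Qed.

Lemma e2pi0 : e2pi (0 : R[i]) = 1.
Proof. by rewrite /e2pi mulr0 /cexp/= expR0 cos0 sin0 mulr1 mulr0. Qed.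

Lemma e2pi_nat (n : nat) : e2pi (n%:R : R[i]) = 1.
Proof.
elim: n => [|n IH]; first exact: e2pi0.
rewrite -natr1 e2piD IH mul1r /e2pi mulr1.
have -> : (2 * pi)%:C * 'i%C = 0 +i* (2 * pi) :> R[i].
  by congr (_ +i* _) => /=; ring.
by rewrite /cexp/= expR0 !mul1r mulr_natl cos2pi sin2pi.
Qed.

Lemma e2piN z : e2pi z * e2pi (- z) = 1.
Proof. by rewrite -e2piD subrr e2pi0. Qed.

Lemma e2pi_int (n : int) : e2pi (n%:~R : R[i]) = 1.
Proof.
case: n => n; first exact: e2pi_nat.
rewrite NegzE rmorphN/=; have := e2piN (n.+1%:~R : R[i]).
by rewrite {1}[e2pi _]e2pi_nat mul1r.
Qed.

Lemma Re_2pii z : complex.Re ((2 * pi)%:C * 'i%C * z) = - (2 * pi * complex.Im z).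
Proof. by case: z => a b /=; ring. Qed.

Lemma normc_e2pi z : normc (e2pi z) = expR (- (2 * pi * complex.Im z)).
Proof. by rewrite normc_cexp Re_2pii. Qed.

Lemma normc_e2pi_real (x : R) : normc (e2pi x%:C) = 1.
Proof. by rewrite normc_e2pi /= mulr0 oppr0 expR0. Qed.

End ComplexExponential.

(** * Primitives of cuspidal q-expansions *)

Lemma eq_ler {R : realType} (x y : R) : x = y -> x <= y.
Proof. by move=> ->. Qed.

Lemma expRN_cube_le {R : realType} (x : R) : 0 < x -> expR (- x) <= 27 / x ^+ 3.
Proof.
move=> x0; rewrite expRN -[leRHS]invrK lef_pV2 ?posrE ?invr_gt0 ?expR_gt0//.
  by rewrite invf_div; exact: expR_cube_ge (ltW x0).
by rewrite divr_gt0 ?exprn_gt0.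
Qed.

Section QSeries.
Context {R : realType}.
Variable l : nat.
Hypothesis l0 : (0 < l)%N.
Implicit Types (a b : nat -> R[i]) (tau s : R[i]).

Let lR : 0 < l%:R :> R. Proof. by rewrite ltr0n. Qed.

Definition omega : R := 2 * pi / l%:R.

Lemma omega_gt0 : 0 < omega.
Proof. by rewrite divr_gt0// mulr_gt0// pi_gt0. Qed.

Definition qmon (n : nat) tau : R[i] := e2pi (n%:R * tau / l%:R).

Lemma normc_qmon n tau : normc (qmon n tau) = expR (- (omega * n%:R * complex.Im tau)).
Proof.
rewrite normc_e2pi; congr (expR (- _)).
have -> : n%:R * tau / l%:R = (n%:R / l%:R)%:C * tau.
  by rewrite !natC -fmorphV mulrAC -rmorphM.
by rewrite ImZ /omega; ring.
Qed.

(** The derivative of the n-th monomial is qrate * n times this monomial. *)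
Definition qrate : R[i] := (2 * pi)%:C * 'i%C / l%:R.

Lemma normc_qrate : normc qrate = omega.
Proof.
rewrite /qrate natC -fmorphV !normcM !normc_real normc_i mulr1 /omega.
by rewrite !ger0_norm ?invr_ge0 ?(ltW lR)// mulr_ge0 ?pi_ge0.
Qed.

Lemma normc_qrateM z : normc (qrate * z) = omega * normc z.
Proof. by rewrite normcM normc_qrate. Qed.

Lemma qmonD n tau s : qmon n (tau + s) = qmon n tau * cexp (qrate * n%:R * s).
Proof.
rewrite /qmon mulrDr mulrDl e2piD; congr (_ * _).
rewrite /e2pi; congr cexp; rewrite /qrate. ring.
Qed.

(** Growth of the coefficients that makes the q-series converge on the whole upper
    half plane. It is stable under multiplication by n and under division by n, hence
    under termwise differentiation and integration. *)
Definition subexp a := forall e : R, 0 < e ->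
  exists M : R, forall n, normc (a n) <= M * expR (omega * n%:R * e).

(** The terms of a convergent series are bounded; at tau = i e this bounds the
    coefficients. *)
Lemma subexp_cvg a : (forall tau, upper_half tau ->
    exists v : R[i]^o, series (fun n => a n * qmon n tau) @ \oo --> v) ->
  subexp a.
Proof.
move=> H e e0; have u : upper_half (0 +i* e : R[i]) by [].
have [v cv] := H _ u.
have := proj1 (@cvgrPdist_lt _ R[i]^o _ _ _ _ v) cv 1 ltr01.
move=> [N _ HN]; set t := fun n => a n * qmon n (0 +i* e).
have tN n : (N <= n)%N -> normc (t n) <= 2.
  move=> Nn.
  have h1 := HN n Nn; have h2 := HN n.+1 (leq_trans Nn (leqnSn n)).
  rewrite /= -normc_normr ltcR in h1; rewrite /= -normc_normr ltcR in h2.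
  have -> : t n = (v - series t n) - (v - series t n.+1).
    have -> : series t n.+1 = series t n + t n by rewrite /series/= big_nat_recr.
    by move: (series t n) (v : R[i]) => x y; rewrite opprB !addrA subrK addrC addKr.
  by apply: le_trans (normcB _ _) _; lra.
exists (2 + \sum_(k < N) normc (t k)) => n.
have E : normc (t n) = normc (a n) / expR (omega * n%:R * e).
  by rewrite normcM normc_qmon /= expRN.
rewrite -ler_pdivrMr ?expR_gt0// -E.
have [/tN h|nN] := leqP N n.
  by rewrite (le_trans h)// lerDl sumr_ge0// => i _; exact: normc_ge0.
rewrite (bigD1 (Ordinal nN))//= addrCA lerDl addr_ge0// sumr_ge0// => i _.
exact: normc_ge0.
Qed.

(** A factor n is absorbed by an exponential of arbitrarily small rate. *)
Lemma subexp_natM a : subexp a -> subexp (fun n => n%:R * a n).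
Proof.
move=> sa e e0; have e2 : 0 < e / 2 by rewrite divr_gt0.
have [M HM] := sa _ e2; exists (M / (omega * (e / 2))) => n.
have w0 := omega_gt0; have we : 0 < omega * (e / 2) by rewrite mulr_gt0.
rewrite normcM normc_nat.
have h : n%:R <= expR (omega * n%:R * (e / 2)) / (omega * (e / 2)).
  rewrite ler_pdivlMr// mulrCA mulrA.
  by have := expR_ge1Dx (omega * n%:R * (e / 2)); lra.
apply: le_trans (ler_pM _ _ h (HM n)) _; rewrite ?normc_ge0//.
rewrite [omega * n%:R * e](_ : _ = omega * n%:R * (e / 2) + omega * n%:R * (e / 2)).
  by rewrite expRD; apply: eq_ler; ring.
by field.
Qed.

Lemma subexp_le a b (c : R) : 0 <= c -> subexp a ->
  (forall n, normc (b n) <= c * normc (a n)) -> subexp b.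
Proof.
move=> c0 sa ab e /sa[M HM]; exists (c * M) => n.
by apply: le_trans (ab n) _; rewrite -mulrA ler_wpM2l.
Qed.

Lemma expR_geometric (c : R) n : expR (- (c * n%:R)) = expR (- c) ^+ n.
Proof. by rewrite -expRM_natl; congr expR; ring. Qed.

Lemma qgeometric (c : R) : 0 < c ->
  rsummable setT (fun n => expR (- (c * n%:R))).
Proof.
move=> c0; under [X in rsummable _ X]eq_fun do rewrite expR_geometric.
by apply: rsummable_geometric; rewrite expR_ge0/= -expR0 ltr_expR oppr_lt0.
Qed.

Lemma qterm_csummable a tau : subexp a -> upper_half tau ->
  csummable setT (fun n => a n * qmon n tau).
Proof.
move=> sa; rewrite /upper_half/= => y0; have y2 : 0 < complex.Im tau / 2 by rewrite divr_gt0.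
have [M HM] := sa _ y2.
have w0 := omega_gt0.
have c0 : 0 < omega * (complex.Im tau / 2) by rewrite mulr_gt0.
apply: (csummable_le (rsummableZ M (qgeometric c0))) => n _.
rewrite normcM normc_qmon; apply: le_trans (ler_wpM2r (expR_ge0 _) (HM n)) _.
rewrite -[_ * _ * expR _]mulrA -expRD; apply: eq_ler; congr (_ * expR _); by field.
Qed.

Definition qsum a tau : R[i] := csum setT (fun n => a n * qmon n tau).

Lemma qsum_cderiv a tau : subexp a -> upper_half tau ->
  cderiv (qsum a) tau (qsum (fun n => qrate * n%:R * a n) tau).
Proof.
move=> sa ut; have y0 : 0 < complex.Im tau := ut.
have w0 := omega_gt0.
have sna := subexp_natM sa; have snna := subexp_natM sna.
have y4 : 0 < complex.Im tau / 4 by rewrite divr_gt0.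
have [M HM] := snna _ y4.
have c0 : 0 < omega * (complex.Im tau / 2) by rewrite mulr_gt0// divr_gt0.
have ups s : normc s < complex.Im tau / 4 -> upper_half (tau + s).
  move=> sd; rewrite /upper_half/= ImD.
  have := Im_le_normc s; rewrite ler_norml => /andP[h _]; lra.
(* The factor n ^ 2 of the second-order term is part of the bound HM; the two
   quarters of Im tau spent on the growth of the coefficients and on s leave
   half of the decay of the exponential. *)
pose B n := 4 * omega ^+ 2 * M * expR (- (omega * (complex.Im tau / 2) * n%:R)).
apply: (@csum_cderiv _ _ _ _ _ B _ (complex.Im tau / 4)) => //.
- exact/rsummableZ/qgeometric.
- apply: qterm_csummable => //; apply: (subexp_le (c := omega) _ sna) => [|n].
    exact: ltW.
  by rewrite -mulrA normc_qrateM.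
- by move=> s /ups us; exact: qterm_csummable.
move=> s sd n _; set k := qrate * n%:R.
have -> : a n * qmon n (tau + s) - a n * qmon n tau - s * (k * a n * qmon n tau) =
   a n * qmon n tau * (cexp (k * s) - 1 - k * s).
  by rewrite qmonD -/k; ring.
rewrite normcM; apply: le_trans (ler_wpM2l (normc_ge0 _) (cexp_taylor1 _)) _.
have nk : normc k = omega * n%:R by rewrite normc_qrateM normc_nat.
clearbody k; rewrite !normcM nk normc_qmon.
have E1 : expR (omega * n%:R * normc s) <= expR (omega * n%:R * (complex.Im tau / 4)).
  by rewrite ler_expR ler_wpM2l ?(ltW sd)// mulr_ge0// ltW.
have HMn := HM n; rewrite !normcM normc_nat in HMn.
rewrite /B.
set x := omega * n%:R in nk E1 HMn *; set y := complex.Im tau in E1 HMn *.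
rewrite (_ : 4 * omega ^+ 2 * M * expR (- (omega * (y / 2) * n%:R)) * normc s ^+ 2 =
  (4 * omega ^+ 2 * normc s ^+ 2) *
    ((M * expR (x * (y / 4))) * (expR (- (x * y)) * expR (x * (y / 4))))).
  rewrite [leLHS](_ : _ = (4 * omega ^+ 2 * normc s ^+ 2) *
    ((n%:R * (n%:R * normc (a n))) * (expR (- (x * y)) * expR (x * normc s))));
    last by rewrite /x; ring.
  have c40 : 0 <= 4 * omega ^+ 2 * normc s ^+ 2.
    by apply: mulr_ge0; [apply: mulr_ge0|]; rewrite ?sqr_ge0.
  rewrite ler_wpM2l// ler_pM ?HMn// ?ler_wpM2l ?expR_ge0//.
  by rewrite !mulr_ge0 ?normc_ge0.
rewrite [M * _ * _]mulrACA -[M * _ * _]mulrA.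
rewrite -[expR (x * (y / 4)) * expR (x * (y / 4))]expRD.
have -> : expR (- (omega * (y / 2) * n%:R)) =
    expR (- (x * y)) * expR (x * (y / 4) + x * (y / 4)).
  by rewrite -expRD; congr expR; rewrite /x; by field.
by ring.
Qed.

(** A q-series without constant term decays exponentially towards i oo; the cube is
    what the integrability of h near a cusp requires, see [cusp_integral_period]. *)
Lemma qsum_decay a (e : R) : subexp a -> a 0%N = 0 -> 0 < e ->
  exists K : R, forall tau, e <= complex.Im tau ->
    normc (qsum a tau) <= K / complex.Im tau ^+ 3.
Proof.
move=> sa a0 e0; have e2 : 0 < e / 2 by rewrite divr_gt0.
have [M HM] := sa _ e2.
have M0 : 0 <= M by have := le_trans (normc_ge0 _) (HM 0%N); rewrite pmulr_lge0 ?expR_gt0.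
have w0 := omega_gt0.
have c0 : 0 < omega * (e / 4) by rewrite mulr_gt0// divr_gt0.
have sg := qgeometric c0.
set S := nnsum setT (fun n => expR (- (omega * (e / 4) * n%:R))).
have S0 : 0 <= S by apply: nnsum_ge0 => n _; exact: expR_ge0.
exists (2 * (M * S * (27 / (omega / 4) ^+ 3))) => tau ey.
set y := complex.Im tau in ey *; have y0 : 0 < y by lra.
have cub : expR (- (omega / 4 * y)) <= 27 / (omega / 4) ^+ 3 / y ^+ 3.
  have x0 : 0 < omega / 4 * y by rewrite mulr_gt0// divr_gt0.
  apply: le_trans (expRN_cube_le x0) _.
  by apply: eq_ler; rewrite exprMn invfM mulrA.
have H n : [set: nat] n -> normc (a n * qmon n tau) <= (M * expR (- (omega / 4 * y))) *
    expR (- (omega * (e / 4) * n%:R)).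
  (* The constant term vanishes, so half of the exponential factor can be bounded
     by its value at n = 1, which carries the decay in Im tau. *)
  move=> _; case: n => [|n].
    by rewrite a0 mul0r normc0; apply: mulr_ge0; [apply: mulr_ge0|]; rewrite ?expR_ge0.
  rewrite normcM normc_qmon; apply: le_trans (ler_wpM2r (expR_ge0 _) (HM _)) _.
  rewrite -[leLHS]mulrA -[leRHS]mulrA ler_wpM2l// -!expRD ler_expR -/y.
  have n1 : 1 <= n.+1%:R :> R by rewrite ler1n.
  have wn : 0 <= omega by exact: ltW.
  suff : n.+1%:R * (e / 2) - n.+1%:R * y <= - (y / 4) - e / 4 * n.+1%:R.
    move=> h; have := ler_wpM2l wn h; lra.
  nra.
apply: le_trans (csum_norm (rsummableZ _ sg) H) _.
rewrite nnsumZ//; last by rewrite mulr_ge0 ?expR_ge0.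
rewrite -/S; set E := expR _ in cub *.
have -> : 2 * (M * S * (27 / (omega / 4) ^+ 3)) / y ^+ 3 =
  2 * (M * (27 / (omega / 4) ^+ 3 / y ^+ 3) * S) by ring.
by rewrite ler_wpM2l// ler_wpM2r// ler_wpM2l.
Qed.

(** Integrating the expansion term by term: the missing constant term is what makes
    the primitive again a q-series, and one that vanishes at i oo. *)
Theorem q_expansion_primitive (f : R[i] -> R[i]) : cuspidal_q_expansion l f ->
  exists F : R[i] -> R[i],
    (forall tau, upper_half tau -> cderiv F tau (f tau)) /\
    forall e : R, 0 < e -> exists K : R, forall tau, e <= complex.Im tau ->
      normc (F tau) <= K / complex.Im tau ^+ 3 /\
      normc (f tau) <= K / complex.Im tau ^+ 3.
Proof.
move=> [a a0 Ha].
have sa : subexp a.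
  by apply: subexp_cvg => tau ut; exists (f tau); exact: Ha.
have fE tau : upper_half tau -> f tau = qsum a tau.
  move=> ut; apply/esym/csum_series; first exact: qterm_csummable.
  exact: Ha.
pose b n : R[i] := a n / (qrate * n%:R).
have w0 := omega_gt0.
have q0 : qrate != 0 by rewrite -normc_gt0 normc_qrate.
have ba n : qrate * n%:R * b n = a n.
  case: n => [|n]; first by rewrite a0 mulr0 mul0r.
  by rewrite /b mulrC divfK// mulf_neq0// pnatr_eq0.
have b0 : b 0%N = 0 by rewrite /b a0 mul0r.
clearbody b; have sb : subexp b.
  apply: (subexp_le (c := omega^-1) _ sa) => [|n]; first by rewrite invr_ge0 ltW.
  case: n => [|n]; first by rewrite b0 a0 normc0 mulr0.
  rewrite -[in leRHS]ba -mulrA normc_qrateM normcM normc_nat mulrA mulVf ?gt_eqF// mul1r.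
  by rewrite ler_peMl ?normc_ge0// ler1n.
exists (qsum b); split=> [tau ut|e e0].
  rewrite fE//; have := qsum_cderiv sb ut.
  by have -> : (fun n => qrate * n%:R * b n) = a by apply/funext.
have [K1 H1] := qsum_decay sb b0 e0.
have [K2 H2] := qsum_decay sa a0 e0.
exists (Num.max K1 K2) => tau ey.
have y0 : 0 < complex.Im tau by exact: lt_le_trans ey.
split.
  apply: le_trans (H1 _ ey) _; rewrite ler_wpM2r ?le_max ?lexx// invr_ge0 exprn_ge0//.
  exact: ltW.
rewrite fE//; apply: le_trans (H2 _ ey) _.
rewrite ler_wpM2r ?le_max ?lexx ?orbT// invr_ge0 exprn_ge0//.
exact: ltW.
Qed.

End QSeries.

(** * The fundamental theorem of calculus on an open half line *)

Section ImproperIntegral.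
Context {R : realType}.
Implicit Types u v : R -> R.
Local Notation mu := (@lebesgue_measure R).

(** The functions to be integrated are only known on positive reals; the fundamental
    theorem on a half line also needs a value at its end point. *)
Definition extend0 v (A : R) (t : R) := if 0 < t then v t else A.

Lemma extend0_near v A (t : R) : 0 < t -> {near t, v =1 extend0 v A}.
Proof.
move=> t0; exists t => // s /= sd; rewrite /extend0 ifT//.
by move: sd; rewrite ltr_distlC subrr => /andP[].
Qed.

Lemma extend0_cts v A (t : R) : 0 < t -> {for t, continuous v} ->
  {for t, continuous (extend0 v A)}.
Proof.
move=> t0 cv; rewrite /prop_for/continuous_at {2}/extend0 t0.
apply: cvg_trans cv; apply: near_eq_cvg.
exact: extend0_near.
Qed.

Lemma extend0_cvg v A : v t @[t --> 0^'+] --> A ->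
  extend0 v A t @[t --> 0^'+] --> extend0 v A 0.
Proof.
move=> cv; rewrite {2}/extend0 ltxx; apply: cvg_trans cv; apply: near_eq_cvg.
by near=> t; rewrite /extend0 ifT.
Unshelve. all: by end_near. Qed.

(** The bounds on v play two roles: K t makes v continuous when extended by 0 at the
    origin, and together with K / t ^ 2 it makes v integrable, being dominated by a
    multiple of 1 / (1 + t ^ 2). *)
Lemma improper_FTC u v (A B K : R) :
  (forall t : R, 0 < t -> is_derive t 1 u (v t)) ->
  (forall t : R, 0 < t -> {for t, continuous v}) ->
  (forall t : R, 0 < t -> t <= 1 -> `|v t| <= K * t) ->
  (forall t : R, 1 <= t -> `|v t| <= K / t ^+ 2) ->
  u t @[t --> 0^'+] --> A -> u t @[t --> +oo] --> B ->
  \int[mu]_(t in `]0, +oo[) v t = B - A.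
Proof.
move=> du cv v0 vy uA uB.
have K0 : 0 <= K.
  by have := le_trans (normr_ge0 _) (v0 1 ltr01 (lexx _)); rewrite mulr1.
have vb (t : R) : 0 < t -> `|v t| <= 2 * K / oneDsqr t.
  move=> t0; have q0 : 0 < oneDsqr t by exact: lt_le_trans (oneDsqr_ge1 t).
  rewrite ler_pdivlMr// /oneDsqr; have [t1|t1] := leP t 1.
    have t2 : t ^+ 2 <= 1 by rewrite expr_le1// ltW.
    apply: le_trans (ler_wpM2r _ (v0 _ t0 t1)) _; first by rewrite addr_ge0// sqr_ge0.
    rewrite [2 * K]mulrC -mulrA ler_wpM2l//; nra.
  have t2 : 0 < t ^+ 2 by rewrite exprn_gt0.
  apply: le_trans (ler_wpM2r _ (vy _ (ltW t1))) _; first by rewrite addr_ge0// sqr_ge0.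
  rewrite mulrAC ler_pdivrMr// [2 * K]mulrC -!mulrA ler_wpM2l//; nra.
set v1 := extend0 v 0; set u1 := extend0 u A.
pose w t : R := (2 * K) * (oneDsqr t)^-1.
have cw : continuous w.
  by move=> t; apply: cvgMl_tmp; exact: continuous_oneDsqrV.
have v1b (t : R) : `|v1 t| <= w t.
  rewrite /v1 /extend0; case: ifPn => [/vb//|_].
  by rewrite normr0 mulr_ge0 ?mulr_ge0// invr_ge0; exact: le_trans (oneDsqr_ge1 t).
have vA : v t @[t --> 0^'+] --> (0 : R).
  apply/cvgrPdist_le => /= e e0; near=> t.
  rewrite sub0r normrN; apply: le_trans (v0 _ _ _) _ => //.
    near: t; apply: nbhs_right_le; exact: ltr01.
  apply: le_trans (_ : (K + 1) * t <= _); first by rewrite ler_wpM2r// lerDl.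
  rewrite mulrC -ler_pdivlMr ?ltr_wpDl//; near: t; apply: nbhs_right_le.
  by rewrite divr_gt0// ltr_wpDl.
have cv1 (t : R) : 0 < t -> {for t, continuous v1} by move=> t0; exact/extend0_cts/cv.
have wcv1 : {within `[0, +oo[, continuous v1}.
  apply/continuous_within_itvcyP; split; last exact: extend0_cvg.
  by move=> t; rewrite in_itv/= andbT; exact: cv1.
have ww : {within `[0, +oo[, continuous w} by apply: continuous_subspaceT.
have du1 (t : R) : 0 < t -> is_derive t 1 u1 (v1 t).
  move=> t0; rewrite /v1 /extend0 t0.
  by apply: near_eq_is_derive (du _ t0); exact: extend0_near.
have u1B : u1 t @[t --> +oo] --> B.
  apply: cvg_trans uB; apply: near_eq_cvg.
  by near=> t; rewrite /u1/extend0 ifT//; near: t; exact: nbhs_pinfty_gt.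
have iq : mu.-integrable `[0, +oo[ (EFin \o (fun t : R => (oneDsqr t)^-1)).
  apply/integrableP; split.
    apply/measurable_EFinP; apply: measurable_funTS.
    by apply: continuous_measurable_fun; exact: continuous_oneDsqrV.
  under eq_integral.
    by move=> t _; rewrite /= ger0_norm ?invr_ge0 ?(le_trans _ (oneDsqr_ge1 t))//; over.
  by rewrite integral0y_oneDsqr ltry.
have mw : mu.-integrable `[0, +oo[ (EFin \o w).
  apply: eq_integrable (integrableZl _ (2 * K) iq) => //.
have mv : mu.-integrable `[0, +oo[ (EFin \o v1).
  apply: le_integrable mw => //.
    by apply/measurable_EFinP; apply: subspace_continuous_measurable_fun.
  move=> t _ /=; rewrite lee_fin [leRHS]ger0_norm ?v1b//.
  exact: le_trans (v1b t).
have iw : \int[mu]_(t in `[0, +oo[) w t = 2 * K * (pi / 2).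
  rewrite RintegralZl//.
  by rewrite /Rintegral integral0y_oneDsqr.
have dw (t : R) : is_derive t 1 (fun t => 2 * K * atan t) (w t).
  exact: (is_deriveZ (2 * K)).
(* The fundamental theorem on a half line is available for nonnegative
   integrands: v1 + w is one, because w dominates the absolute value of v1. *)
have ivw : \int[mu]_(t in `[0, +oo[) (v1 t + w t) = (B + 2 * K * (pi / 2)) - A.
  rewrite (@Rintegral_ge0_continuous_FTC2y _ _ (fun t => u1 t + 2 * K * atan t) _
    (B + 2 * K * (pi / 2))).
  - by rewrite atan0 mulr0 addr0 {1}/u1 /extend0 ltxx.
  - move=> t _; have := v1b t; rewrite ler_norml => /andP[h _]; lra.
  - by move=> t; apply: cvgD; [exact: wcv1|exact: ww].
  - by apply: cvgD => //; apply: cvgMl_tmp; exact: cvgy_atan.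
  - by move=> t t0; apply: derivableD; [case: (du1 _ t0)|case: (dw t)].
  - apply: cvgD; first exact: extend0_cvg.
    by apply: cvgMl_tmp; apply: cvg_at_right_filter; exact: continuous_atan.
  - move=> t; rewrite in_itv/= andbT => t0; rewrite derive1E.
    by have := is_deriveD (du1 _ t0) (dw t); case.
rewrite RintegralD// iw in ivw.
rewrite (_ : Rintegral _ _ _ = \int[mu]_(t in `]0, +oo[) v1 t); last first.
  by apply: eq_Rintegral => t; rewrite inE/= in_itv/= andbT /v1/extend0 => ->.
rewrite Rintegral_itv_obnd_cbnd; first by lra.
by apply: integrableS mv => //; by apply: subset_itvr; rewrite bnd_simp.
Unshelve. all: by end_near. Qed.

End ImproperIntegral.

(** * The modular group and Moebius transformations *)

Section TwoByTwo.
Implicit Types g m : 'M[int]_2.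

Lemma ord2 : lift ord0 ord0 = 1 :> 'I_2.
Proof. exact/val_inj. Qed.

Lemma ord2P (i : 'I_2) : i = 0 \/ i = 1.
Proof. by case: i => [[|[|//]] ?]; [left|right]; exact: val_inj. Qed.

Lemma mulmx2 g m i j : (g *m m) i j = g i 0 * m 0 j + g i 1 * m 1 j.
Proof. by rewrite mxE !big_ord_recl big_ord0 addr0 !ord2. Qed.

Lemma det2 g : \det g = g 0 0 * g 1 1 - g 0 1 * g 1 0.
Proof.
have l01 : lift (0 : 'I_2) (0 : 'I_1) = 1 by exact/val_inj.
have l10 : lift (1 : 'I_2) (0 : 'I_1) = 0 by exact/val_inj.
rewrite (expand_det_row _ 0) !big_ord_recl big_ord0 addr0 !ord2 /cofactor !det_mx11 !mxE.
by rewrite l01 l10 /= addn0 expr0 mul1r expr1 mulN1r mulrN.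
Qed.

Definition mat2 (a b c d : int) : 'M[int]_2 :=
  \matrix_(i, j) if i == 0 then (if j == 0 then a else b)
                 else (if j == 0 then c else d).

Lemma mat2E a b c d : (mat2 a b c d 0 0 = a) * (mat2 a b c d 0 1 = b) *
  (mat2 a b c d 1 0 = c) * (mat2 a b c d 1 1 = d).
Proof. by rewrite !mxE. Qed.

Lemma SL2Z_det g : SL2Z g -> g 0 0 * g 1 1 - g 0 1 * g 1 0 = 1.
Proof. by rewrite -det2. Qed.

Lemma SL2Z_mat2 a b c d : a * d - b * c = 1 -> SL2Z (mat2 a b c d).
Proof. by move=> E; rewrite /SL2Z/= det2 !mat2E. Qed.

Lemma SL2Z_mul g m : SL2Z g -> SL2Z m -> SL2Z (g *m m).
Proof. by rewrite /SL2Z/= det_mulmx => -> ->. Qed.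

Definition inv2 g := mat2 (g 1 1) (- g 0 1) (- g 1 0) (g 0 0).

Lemma SL2Z_inv g : SL2Z g -> SL2Z (inv2 g).
Proof. by move=> /SL2Z_det dg; apply: SL2Z_mat2; rewrite -dg; ring. Qed.

End TwoByTwo.

Section Moebius.
Context {R : realType}.
Implicit Types (g m : 'M[int]_2) (tau : R[i]).

Lemma Im_int_mul (c : int) tau : complex.Im (c%:~R * tau) = c%:~R * complex.Im tau.
Proof. by rewrite intC ImZ. Qed.

Lemma linform_neq0 (c d : int) tau : upper_half tau -> (c, d) != (0, 0) ->
  c%:~R * tau + d%:~R != 0.
Proof.
move=> ut cd; apply/eqP => E.
have /eqP : complex.Im (c%:~R * tau + d%:~R) = 0 by rewrite E.
rewrite ImD Im_int_mul intC /= addr0 mulf_eq0 (gt_eqF ut) orbF intr_eq0 => /eqP c0.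
move: E cd; rewrite c0 mul0r add0r => /eqP; rewrite intr_eq0 => /eqP ->.
by rewrite eqxx.
Qed.

Lemma SL2Z_row g : SL2Z g -> (g 1 0, g 1 1) != (0, 0).
Proof.
move=> /SL2Z_det dg; apply/eqP => -[c0 d0]; move: dg; rewrite c0 d0 !mulr0 subrr.
by move=> /eqP; rewrite eq_sym oner_eq0.
Qed.

Lemma autfactor_neq0 g tau : SL2Z g -> upper_half tau -> autfactor g tau != 0.
Proof. by move=> sg ut; apply: linform_neq0 => //; exact: SL2Z_row. Qed.

Lemma SL2Z_detC g : SL2Z g ->
  (g 0 0)%:~R * (g 1 1)%:~R - (g 0 1)%:~R * (g 1 0)%:~R = 1 :> R[i].
Proof. by move=> /SL2Z_det dg; rewrite -!rmorphM -rmorphB dg. Qed.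

(** The determinant of the matrix is the numerator of the imaginary part. *)
Lemma Im_mobius g tau : SL2Z g -> upper_half tau ->
  complex.Im (mobius g tau) = complex.Im tau / normc (autfactor g tau) ^+ 2.
Proof.
move=> sg ut; have j0 := autfactor_neq0 sg ut.
have dR : (g 0 0)%:~R * (g 1 1)%:~R - (g 0 1)%:~R * (g 1 0)%:~R = 1 :> R.
  by rewrite -!rmorphM -rmorphB (SL2Z_det sg).
move: j0; rewrite /mobius /autfactor !intC; case: tau ut => x y ut j0.
have q0 : ((g 1 0)%:~R * x + (g 1 1)%:~R) ^+ 2 + ((g 1 0)%:~R * y) ^+ 2 != 0 :> R.
  apply: contraNneq j0 => /eqP.
  rewrite paddr_eq0 ?sqr_ge0// !expf_eq0/= => /andP[/eqP h1 /eqP h2].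
  by rewrite eq_complex /= !mul0r !subr0 !addr0 h1 h2 !eqxx.
rewrite /= !mul0r !subr0 !addr0 sqr_sqrtr ?addr_ge0 ?sqr_ge0//.
move: q0 dR; move: (g 0 0)%:~R (g 0 1)%:~R (g 1 0)%:~R (g 1 1)%:~R => a b c d q0 dR.
transitivity ((a * d - b * c) * y / ((c * x + d) ^+ 2 + (c * y) ^+ 2)).
  by ring.
by rewrite dR mul1r.
Qed.

Lemma mobius_upper g tau : SL2Z g -> upper_half tau -> upper_half (mobius g tau).
Proof.
move=> sg ut; rewrite /upper_half/= Im_mobius// divr_gt0 ?exprn_gt0//.
by rewrite normc_gt0 autfactor_neq0.
Qed.

(** Moving g from the argument to the row: the row (c, d) becomes (c, d) g. *)
Lemma linform_mobius (c d : int) g tau : SL2Z g -> upper_half tau ->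
  c%:~R * mobius g tau + d%:~R =
  ((c * g 0 0 + d * g 1 0)%:~R * tau + (c * g 0 1 + d * g 1 1)%:~R) / autfactor g tau.
Proof.
move=> sg ut; have := autfactor_neq0 sg ut.
rewrite /mobius /autfactor !rmorphD !rmorphM /= => j0.
by field.
Qed.

Lemma autfactor_mul g m tau : SL2Z m -> upper_half tau ->
  autfactor (g *m m) tau = autfactor g (mobius m tau) * autfactor m tau.
Proof.
move=> sm ut; rewrite {2}/autfactor linform_mobius// divfK ?autfactor_neq0//.
by rewrite /autfactor !mulmx2.
Qed.

Lemma mobius_mul g m tau : SL2Z m -> upper_half tau ->
  mobius (g *m m) tau = mobius g (mobius m tau).
Proof.
move=> sm ut; have j0 := autfactor_neq0 sm ut.
rewrite {1 2}/mobius autfactor_mul// linform_mobius// !mulmx2.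
by rewrite invfM [X in _ * X = _]mulrC mulrA.
Qed.

Lemma mobius1 tau : mobius 1%:M tau = tau.
Proof. by rewrite /mobius /autfactor !mxE/= mul1r mul0r add0r addr0 divr1. Qed.

Lemma autfactor1 tau : autfactor 1%:M tau = 1.
Proof. by rewrite /autfactor !mxE/= mul0r add0r. Qed.

Lemma mobius_cderiv g tau : SL2Z g -> upper_half tau ->
  cderiv (mobius g) tau (autfactor g tau ^- 2).
Proof.
move=> sg ut; have j0 := autfactor_neq0 sg ut; have dg := SL2Z_detC sg.
set j := autfactor g tau in j0 *; set c : R[i] := (g 1 0)%:~R.
have nj : 0 < normc j by rewrite normc_gt0.
have nc : 0 < 1 + normc c by rewrite ltr_pwDl// normc_ge0.
apply: (@cderiv_quadratic _ _ _ _ (2 * normc c / normc j ^+ 3) (normc j / 2 / (1 + normc c))).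
  by rewrite !divr_gt0.
move=> s sd; have jE : autfactor g (tau + s) = j + c * s.
  by rewrite /j /autfactor -/c; ring.
(* The denominator j + c s stays away from 0 for small s. *)
have jj : normc j / 2 <= normc (j + c * s).
  apply: le_trans (normcB_ge _ _); rewrite lerBrDr -lerBrDl normcM.
  apply: le_trans (_ : (1 + normc c) * normc s <= _).
    by rewrite ler_wpM2r ?normc_ge0// lerDr.
  by rewrite mulrC -ler_pdivlMr// (le_trans (ltW sd))// ler_wpM2r ?invr_ge0 ?(ltW nc)//; lra.
have j1 : j + c * s != 0 by rewrite -normc_gt0 (lt_le_trans _ jj)// divr_gt0.
have -> : mobius g (tau + s) - mobius g tau - s * j ^- 2 =
    - c * s ^+ 2 / (j ^+ 2 * (j + c * s)).
  rewrite /mobius jE -/j; move: dg j0 j1; rewrite /j /autfactor -/c.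
  move: (g 0 0)%:~R (g 0 1)%:~R (g 1 1)%:~R => a b d dg j0 j1.
  rewrite (_ : s * _ ^- 2 = (a * d - b * c) * s / (c * tau + d) ^+ 2);
    last by rewrite dg mul1r.
  rewrite (_ : - c * s ^+ 2 = - (a * d - b * c) * c * s ^+ 2); last by rewrite dg mulN1r.
  by field; rewrite j0 j1.
have X0 : 0 < normc (j + c * s) by rewrite normc_gt0.
rewrite !normcM normcV normcN normcM !normcX.
move: (normc j) (normc (j + c * s)) (normc c) (normc s) nj jj X0
  (normc_ge0 c) (normc_ge0 s) => J X C S J0 JX X0 C0 S0.
rewrite ler_pdivrMr; last by rewrite mulr_gt0// exprn_gt0.
rewrite [leRHS](_ : _ = (C * S ^+ 2) * (2 * X / J)); last by field; rewrite gt_eqF.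
rewrite ler_peMr ?mulr_ge0 ?exprn_ge0// ler_pdivlMr// mul1r; lra.
Qed.

End Moebius.

(** * Periods of a cusp form of weight two *)

Section Periods.
Context {R : realType}.
Variables (l : nat) (h F : R[i] -> R[i]).
Hypothesis l0 : (0 < l)%N.
Hypothesis hh : cusp_form 2 l h.
Hypothesis dF : forall tau, upper_half tau -> cderiv F tau (h tau).
Hypothesis F_decay : forall e : R, 0 < e -> exists K : R, forall tau,
  e <= complex.Im tau -> normc (F tau) <= K / complex.Im tau ^+ 3 /\
      normc (h tau) <= K / complex.Im tau ^+ 3.
Implicit Types (g m : 'M[int]_2) (tau : R[i]).

(** The number C is the value at the cusp m oo of the primitive F of h, that is, the
    integral of h from i oo to m oo. It is approached in the horoballs at m oo, on
    which Im tau is large, so that the path towards the cusp does not matter. *)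
Definition period m (C : R[i]) := exists K : R, forall tau,
  1 <= complex.Im tau -> normc (F (mobius m tau) - C) <= K / complex.Im tau ^+ 3.

Let upper_half_i : upper_half ('i%C : R[i]).
Proof. exact: ltr01. Qed.

Lemma vertical_decay_eq0 (w : R[i]) (K : R) :
  (forall t : R, 1 <= t -> normc w <= K / t ^+ 3) -> w = 0.
Proof.
move=> H; apply/eqP; rewrite -[_ == _]negbK -normc_gt0; apply/negP => w0.
have K0 : 0 <= K by have := H 1 (lexx _); rewrite expr1n divr1; exact/le_trans/ltW.
have t1 : 1 <= 1 + K / normc w by rewrite lerDl divr_ge0// ltW.
have tp : 0 < 1 + K / normc w by lra.
have := H _ t1; rewrite ler_pdivlMr ?exprn_gt0// leNgt => /negP; apply.
apply: lt_le_trans (_ : normc w * (1 + K / normc w) <= _).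
  by rewrite mulrDr mulr1 mulrCA divff ?gt_eqF// mulr1 ltrDr.
by rewrite ler_wpM2l ?(ltW w0)// ler_eXnr.
Qed.

Lemma period_unique m C D : period m C -> period m D -> C = D.
Proof.
move=> [K HK] [L HL]; apply/eqP; rewrite -subr_eq0; apply/eqP.
apply: (@vertical_decay_eq0 _ (K + L)) => t t1.
have := lerD (HL (0 +i* t) t1) (HK (0 +i* t) t1) => /=.
rewrite -mulrDl [L + K]addrC; apply: le_trans.
rewrite -(normcN (_ - C)); apply: le_trans (normcD _ _).
by apply: eq_ler; congr normc; ring.
Qed.

Lemma F_mobius_cderiv g tau : SL2Z g -> upper_half tau ->
  cderiv (fun w => F (mobius g w)) tau (slash 2 h g tau).
Proof.
move=> sg ut; rewrite /slash mulrC; apply: cderiv_comp; first exact: mobius_cderiv.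
exact/dF/mobius_upper.
Qed.

(** The function slash 2 h m is the derivative of F (m tau), and its own q-expansion
    gives another primitive, which vanishes at i oo. The two primitives differ by a
    constant, the period. *)
Lemma period_exists m : SL2Z m -> exists C, period m C /\
  forall e : R, 0 < e -> exists K : R, forall tau, e <= complex.Im tau ->
    normc (slash 2 h m tau) <= K / complex.Im tau ^+ 3.
Proof.
move=> sm; have [_ _ /(_ m sm)/(q_expansion_primitive l0)[G [dG decG]]] := hh.
exists (F (mobius m 'i%C) - G 'i%C); split; last first.
  by move=> e /decG[K HK]; exists K => tau /HK[].
have [K HK] := decG _ ltr01; exists K => tau t1.
have ut : upper_half tau by rewrite /upper_half/=; lra.
(* Both terms have the derivative slash 2 h m. *)
have E : F (mobius m tau) - G tau = F (mobius m 'i%C) - G 'i%C.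
  apply: (@cderiv0_cst _ (fun w => F (mobius m w) - G w)) => // w uw.
  rewrite -[0](subrr (slash 2 h m w)); apply: cderivD; first exact: F_mobius_cderiv.
  exact/cderivN/dG.
by rewrite -E opprB addrCA subrr addr0; case: (HK _ t1).
Qed.

(** For g in Gamma0 l, modularity of weight 2 says that F (g tau) and F tau have the
    same derivative. *)
Lemma period_Gamma0 g : Gamma0 l g -> exists2 C, period g C &
  forall tau, upper_half tau -> F (mobius g tau) = F tau + C.
Proof.
move=> Gg; have sg := Gg.1; have [_ hmod _] := hh.
have E tau : upper_half tau -> F (mobius g tau) = F tau + (F (mobius g 'i%C) - F 'i%C).
  move=> ut; apply/eqP; rewrite addrC -subr_eq; apply/eqP.
  apply: (@cderiv0_cst _ (fun w => F (mobius g w) - F w)) => // w uw.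
  have -> : 0 = slash 2 h g w - h w.
    rewrite /slash hmod// mulrAC divff ?mul1r ?subrr// expf_neq0//.
    exact: autfactor_neq0.
  by apply: cderivD; [exact: F_mobius_cderiv|exact/cderivN/dF].
exists (F (mobius g 'i%C) - F 'i%C) => //.
have [K HK] := F_decay ltr01; exists K => tau t1.
have ut : upper_half tau by rewrite /upper_half/=; lra.
by rewrite E// addrK; case: (HK _ t1).
Qed.

(** Additivity of the integral along i oo, g oo, g m oo, combined with the invariance
    of h(s) ds under g. *)
Lemma period_mul g m C D : Gamma0 l g -> SL2Z m -> period g C -> period m D ->
  period (g *m m) (C + D).
Proof.
move=> Gg sm pC [K HK]; have [C' pC' E] := period_Gamma0 Gg.
rewrite (period_unique pC pC'); exists K => tau t1.
have ut : upper_half tau by rewrite /upper_half/=; lra.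
rewrite mobius_mul// E; last exact: mobius_upper.
rewrite (_ : _ - _ = F (mobius m tau) - D); first exact: HK.
by ring.
Qed.

Let line (x t : R) : R[i] := x%:C + t%:C * 'i%C.

Let lineE x t : line x t = x +i* t.
Proof. by rewrite /line; congr (_ +i* _) => /=; ring. Qed.

Let line_upper x t : 0 < t -> upper_half (line x t).
Proof. by rewrite lineE. Qed.

Lemma h_line_continuous (x t : R) : 0 < t -> forall e : R, 0 < e ->
  \forall s \near t, normc (h (line x t) - h (line x s)) < e.
Proof.
move=> t0 e e0; have [hd _ _] := hh.
have /derivable1_diffP/differentiable_continuous := hd _ (line_upper x t0).
move=> /(proj1 (@cvgrPdist_lt _ R[i]^o _ _ _ _ _))/(_ e%:C).
rewrite ltcR => /(_ e0)[d /= d0 Hd].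
have d0' : 0 < complex.Re d by move: d0; rewrite ltcE => /andP[].
have dE : d = (complex.Re d)%:C.
  by move: d0; rewrite ltcE => /andP[/eqP/= + _]; case: (d) => a b /= ->.
exists (complex.Re d) => //= s st.
have := Hd (line x s) _; rewrite -normc_normr ltcR; apply.
rewrite /= dE -normc_normr ltcR.
rewrite (_ : line x t - line x s = (t - s)%:C * 'i%C); last first.
  by rewrite /line rmorphB/=; ring.
by rewrite normcM normc_real normc_i mulr1.
Qed.

Lemma line_continuous (L : R[i] -> R) (x t : R) : 0 < t ->
  (forall z, `|L z| <= normc z) -> (forall z w, L (z - w) = L z - L w) ->
  {for t, continuous (fun s => L (h (line x s)))}.
Proof.
move=> t0 LN LB; apply/cvgrPdist_lt => e e0.
apply: filterS (h_line_continuous x t0 e0) => s; apply: le_lt_trans.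
by rewrite -LB.
Qed.

(** The derivative of t |-> F (x + i t) is i h (x + i t). The rates at which h vanishes
    towards the two ends of the line are those of [improper_FTC]. *)
Lemma line_integral (x K : R) (C : R[i]) :
  (forall t : R, 0 < t -> t <= 1 -> normc (h (line x t)) <= K * t) ->
  (forall t : R, 1 <= t -> normc (h (line x t)) <= K / t ^+ 2) ->
  (forall e : R, 0 < e -> \forall t \near 0^'+, normc (C - F (line x t)) <= e) ->
  (forall e : R, 0 < e -> \forall t \near +oo, normc (F (line x t)) <= e) ->
  cintegral `]0, +oo[ (fun t => h (x +i* t)) = 'i%C * C.
Proof.
move=> b0 byy c0 cy; rewrite /cintegral.
under eq_Rintegral do rewrite -lineE.
under [in X in _ +i* X]eq_Rintegral do rewrite -lineE.
have dN (t : R) : 0 < t -> cderiv (fun w => - F w) (line x t) (- h (line x t)).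
  by move=> t0; apply/cderivN/dF; exact: line_upper.
have I1 : \int[lebesgue_measure]_(t in `]0, +oo[) complex.Re (h (line x t)) = 0 - complex.Im C.
  apply: (improper_FTC (u := fun t => complex.Im (F (line x t))) (K := K)).
  - move=> t t0; rewrite -[complex.Re _]ImiRe mulrC.
    exact: is_derive_Im_path (dF (line_upper x t0)).
  - move=> t t0; apply: (line_continuous (L := @complex.Re R)) => //; first exact: Re_le_normc.
    by move=> z w; rewrite ReD ReN.
  - by move=> t t0 t1; apply: le_trans (Re_le_normc _) (b0 _ t0 t1).
  - by move=> t t1; apply: le_trans (Re_le_normc _) (byy _ t1).
  - apply/cvgrPdist_le => e /c0; apply: filterS => t; apply: le_trans.
    by rewrite -ImN -ImD; exact: Im_le_normc.
  - apply/cvgrPdist_le => e /cy; apply: filterS => t; apply: le_trans.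
    by rewrite sub0r normrN; exact: Im_le_normc.
have I2 : \int[lebesgue_measure]_(t in `]0, +oo[) complex.Im (h (line x t)) =
    0 - - complex.Re C.
  apply: (improper_FTC (u := fun t => complex.Re (- F (line x t))) (K := K)).
  - move=> t t0; rewrite (_ : complex.Im _ = complex.Re ('i%C * - h (line x t))).
      exact: (is_derive_Re_path (f := fun w => - F w) (dN _ t0)).
    by rewrite mulrN ReN mulrC ReiNIm opprK.
  - move=> t t0; apply: (line_continuous (L := @complex.Im R)) => //; first exact: Im_le_normc.
    by move=> z w; rewrite ImD ImN.
  - by move=> t t0 t1; apply: le_trans (Im_le_normc _) (b0 _ t0 t1).
  - by move=> t t1; apply: le_trans (Im_le_normc _) (byy _ t1).
  - apply/cvgrPdist_le => e /c0; apply: filterS => t; apply: le_trans.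
    by rewrite -opprD normrN -ReD; exact: Re_le_normc.
  - apply/cvgrPdist_le => e /cy; apply: filterS => t; apply: le_trans.
    by rewrite sub0r normrN ReN normrN; exact: Re_le_normc.
rewrite I1 I2 !sub0r opprK; case: (C) => a b.
by congr (_ +i* _) => /=; ring.
Qed.

(** The vertical line above the cusp m oo is the image under m of a vertical line, the
    height t corresponding to 1 / (q ^ 2 t). Going down to the cusp is therefore going
    up to i oo in the coordinate tau, where q-expansions control everything. *)
Lemma mobius_line m (t : R) : SL2Z m -> m 1 0 != 0 -> 0 < t ->
  let q : R := (m 1 0)%:~R in
  let tau := (- ((m 1 1)%:~R / q)) +i* (q ^+ 2 * t)^-1 in
  [/\ upper_half tau, mobius m tau = line ((m 0 0)%:~R / q) t
    & autfactor m tau = ((q * t)^-1)%:C * 'i%C].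
Proof.
move=> sm q0 t0 q tau.
have qn : q != 0 by rewrite intr_eq0.
have q2 : 0 < q ^+ 2 * t by rewrite mulr_gt0// exprn_even_gt0.
have dR : (m 0 0)%:~R * (m 1 1)%:~R - (m 0 1)%:~R * q = 1 :> R.
  by rewrite -!rmorphM -rmorphB (SL2Z_det sm).
have jE : autfactor m tau = ((q * t)^-1)%:C * 'i%C.
  rewrite /autfactor !intC -/q /tau; congr (_ +i* _) => /=;
    by field; rewrite ?qn ?(gt_eqF t0).
split=> //; first by rewrite /upper_half/= invr_gt0.
rewrite /mobius jE; apply/eqP; rewrite eq_sym -subr_eq0.
have j0 : ((q * t)^-1)%:C * 'i%C != 0 :> R[i].
  by rewrite -normc_gt0 normcM normc_real normc_i mulr1 normr_gt0 invr_eq0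
    mulf_neq0// lt0r_neq0.
rewrite -(inj_eq (mulIf j0)) mul0r mulrBl divfK// subr_eq0.
rewrite lineE !intC /tau; apply/eqP; congr (_ +i* _) => /=.
  have -> : (m 0 1)%:~R = ((m 0 0)%:~R * (m 1 1)%:~R - 1) / q.
    by apply: (mulIf qn); rewrite divfK//; lra.
  by field; rewrite ?qn ?(gt_eqF t0).
by field; rewrite ?qn ?(gt_eqF t0).
Qed.

(** The row (c, d) need not be primitive: t is its content, up to sign. Near the cusp,
    h (m tau) = slash 2 h m tau * autfactor m tau ^ 2, and cubic decay of the first factor
    against the quadratic growth of the second one leaves a factor t. *)
Theorem cusp_integral_period (c d t : int) m C : SL2Z m -> t != 0 ->
  m 0 0 * t = - d -> m 1 0 * t = c -> period m C -> cusp_integral h c d = C.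
Proof.
move=> sm t0 Ed Ec pC; rewrite /cusp_integral; case: ifPn => [/eqP c0|c0].
  have q0 : m 1 0 = 0.
    by move: Ec; rewrite c0 => /eqP; rewrite mulf_eq0 (negPf t0) orbF => /eqP.
  (* The cusp is i oo, where Im (m tau) = Im tau and F tends to 0. *)
  apply: (@period_unique m) => //; have [K HK] := F_decay ltr01.
  exists K => tau t1; have ut : upper_half tau by rewrite /upper_half/=; lra.
  have := Im_mobius sm ut.
  have -> : normc (autfactor m tau) ^+ 2 = 1.
    have := SL2Z_det sm; rewrite q0 mulr0 subr0 => dd.
    have /eqP : muln (absz (m 0 0)) (absz (m 1 1)) = 1%N by rewrite -abszM dd.
    rewrite muln_eq1 => /andP[_ /eqP d1].
    by rewrite /autfactor q0 mul0r add0r normc_int -intr_norm -abszE d1 expr1n.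
  rewrite divr1 => E; rewrite subr0 -E; have [] // := HK (mobius m tau).
  by rewrite E.
have q0 : m 1 0 != 0 by apply: contraNneq c0 => q0; rewrite -Ec q0 mul0r.
set q : R := (m 1 0)%:~R; have qn : q != 0 by rewrite intr_eq0.
have q2 : 0 < q ^+ 2 by rewrite exprn_even_gt0.
have xE : - (d%:~R / c%:~R) = (m 0 0)%:~R / q :> R.
  have tn : t%:~R != 0 :> R by rewrite intr_eq0.
  rewrite -mulNr -rmorphN -Ed -Ec !rmorphM/= -/q; field.
  by rewrite ?tn ?qn.
have [C' [_ decS]] := period_exists sm.
have [Ks HKs] : exists K : R, forall tau, (q ^+ 2)^-1 <= complex.Im tau ->
    normc (slash 2 h m tau) <= K / complex.Im tau ^+ 3.
  by apply: decS; rewrite invr_gt0.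
have [Kh HKh] := F_decay ltr01.
have [Kp HKp] := pC.
set x := (m 0 0)%:~R / q in xE *.
have lineS (s : R) : 0 < s -> exists2 tau, complex.Im tau = (q ^+ 2 * s)^-1 &
    [/\ upper_half tau, mobius m tau = line x s
      & normc (autfactor m tau) ^+ 2 = (q ^+ 2 * s ^+ 2)^-1].
  move=> s0; have [ut lt jt] := mobius_line sm q0 s0.
  eexists; last (split; [exact: ut|exact: lt|]); first by [].
  rewrite jt normcM normc_real normc_i mulr1 real_normK ?num_real//.
  by rewrite exprVn exprMn.
rewrite xE (@line_integral _ (`|Ks * q ^+ 4| + `|Kh|) C).
- by rewrite mulrA mulNr -expr2 sqr_i opprK mul1r.
- move=> s s0 s1; have [tau It [ut <- nj]] := lineS s s0.
  have jn : autfactor m tau ^+ 2 != 0 by rewrite expf_neq0// autfactor_neq0.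
  have -> : h (mobius m tau) = slash 2 h m tau * autfactor m tau ^+ 2.
    by rewrite /slash divfK.
  rewrite normcM normcX nj.
  have lI : (q ^+ 2)^-1 <= complex.Im tau.
    have q2s : 0 < q ^+ 2 * s by apply: mulr_gt0.
    by rewrite It lef_pV2 ?posrE// ler_piMr// ltW.
  have p0 : 0 <= (q ^+ 2 * s ^+ 2)^-1 by rewrite invr_ge0; apply: mulr_ge0; rewrite sqr_ge0.
  apply: le_trans (ler_wpM2r p0 (HKs _ lI)) _; rewrite It.
  rewrite [leLHS](_ : _ = Ks * q ^+ 4 * s); last by field; rewrite ?qn ?(gt_eqF s0).
  by rewrite ler_wpM2r ?(ltW s0)// (le_trans (ler_norm _))// lerDl.
- move=> s s1; have s0 : 0 < s by lra.
  rewrite lineE; have [_] := HKh (x +i* s) s1; move=> /le_trans; apply => /=.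
  apply: le_trans (_ : `|Kh| / s ^+ 3 <= _).
    by rewrite ler_wpM2r ?ler_norm// invr_ge0 exprn_ge0// ltW.
  apply: le_trans (_ : `|Kh| / s ^+ 2 <= _).
    by rewrite ler_wpM2l// lef_pV2 ?posrE ?exprn_gt0// ler_weXn2l.
  by rewrite ler_wpM2r ?lerDr// invr_ge0 exprn_ge0// ltW.
- move=> e e0; near=> s; have s0 : 0 < s by [].
  have [tau It [ut <- nj]] := lineS s s0.
  have p0 : 0 < q ^+ 2 * s by rewrite mulr_gt0.
  have p1 : q ^+ 2 * s <= 1.
    rewrite mulrC -ler_pdivlMr//; near: s; apply: nbhs_right_le.
    by rewrite divr_gt0.
  have t1 : 1 <= complex.Im tau by rewrite It invf_ge1.
  rewrite normc_distC; apply: le_trans (HKp _ t1) _; rewrite It exprVn invrK.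
  apply: le_trans (_ : `|Kp| * (q ^+ 2 * s) <= _).
    apply: le_trans (_ : `|Kp| * (q ^+ 2 * s) ^+ 3 <= _).
      by rewrite ler_wpM2r ?ler_norm// exprn_ge0// ltW.
    rewrite ler_wpM2l// exprS ler_piMr ?(ltW p0)// expr_le1// ltW//.
  apply: le_trans (_ : (`|Kp| + 1) * (q ^+ 2 * s) <= _).
    by rewrite ler_wpM2r ?(ltW p0)// lerDl.
  have k0 : 0 < (`|Kp| + 1) * q ^+ 2 by rewrite mulr_gt0// ltr_wpDl.
  rewrite mulrA mulrC -ler_pdivlMr//; near: s; apply: nbhs_right_le.
  by rewrite divr_gt0// mulr_gt0// ltr_wpDl.
- move=> e e0; near=> s; have s1 : 1 <= s by near: s; apply: nbhs_pinfty_ge; exact: num_real.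
  have s0 : 0 < s by lra.
  rewrite lineE; have [+ _] := HKh (x +i* s) s1; move=> /le_trans; apply => /=.
  apply: le_trans (_ : `|Kh| / s ^+ 3 <= _).
    by rewrite ler_wpM2r ?ler_norm// invr_ge0 exprn_ge0// ltW.
  apply: le_trans (_ : `|Kh| / s <= _).
    by rewrite ler_wpM2l// lef_pV2 ?posrE ?exprn_gt0// ler_eXnr.
  rewrite ler_pdivrMr// mulrC -ler_pdivrMr//; near: s; exact: nbhs_pinfty_ge.
Unshelve. all: by end_near. Qed.

End Periods.

(** * Summability over the lattice *)

Section ActionOnRows.
Implicit Types (g : 'M[int]_2) (p : int * int).

Definition row_act g p : int * int :=
  (p.1 * g 0 0 + p.2 * g 1 0, p.1 * g 0 1 + p.2 * g 1 1).

Definition nonzero_rows : set (int * int) := [set p | p != (0, 0)].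

Lemma row_actK g : SL2Z g -> cancel (row_act g) (row_act (inv2 g)).
Proof.
move=> /SL2Z_det dg [c d]; rewrite /row_act /inv2 !mat2E /=.
rewrite -[in RHS](mul1r c) -[in RHS](mul1r d) -dg.
by congr (_, _); ring.
Qed.

Lemma inv2K g : inv2 (inv2 g) = g.
Proof.
apply/matrixP => i j; rewrite /inv2.
by case: (ord2P i) => ->; case: (ord2P j) => ->; rewrite !mat2E ?opprK.
Qed.

Lemma row_actVK g : SL2Z g -> cancel (row_act (inv2 g)) (row_act g).
Proof. by move=> /SL2Z_inv/row_actK; rewrite inv2K. Qed.

Lemma row_act_nonzero g p : SL2Z g -> nonzero_rows p -> nonzero_rows (row_act g p).
Proof.
move=> sg; apply: contra_neq => E; rewrite -(row_actK sg p) E.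
by rewrite /row_act !mul0r addr0.
Qed.

Lemma row_act_bij g (D : set (int * int)) : SL2Z g ->
  (forall p, D p -> D (row_act g p)) -> (forall p, D p -> D (row_act (inv2 g) p)) ->
  set_bij D D (row_act g).
Proof.
move=> sg Dg Dgi; split; first by move=> p /= /Dg.
- by move=> p q _ _; exact: (can_inj (row_actK sg)).
- by move=> p /Dgi Dp; exists (row_act (inv2 g) p) => //; exact: row_actVK.
Qed.

Lemma row_act_nonzero_bij g : SL2Z g ->
  set_bij nonzero_rows nonzero_rows (row_act g).
Proof.
move=> sg; apply: row_act_bij => // p; first exact: row_act_nonzero.
exact/row_act_nonzero/SL2Z_inv.
Qed.

End ActionOnRows.

Section LatticeSum.
Context {R : realType}.
Implicit Types (tau : R[i]) (p : int * int).

(** The number (n + 1) ^ (-3/2). The exponent 3/2 is half of the smallest weight: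
    it makes the product of two such factors dominate the inverse cube of the norm
    of a row, and is still greater than 1. *)
Definition invpow32 (n : nat) : R := (Num.sqrt n.+1%:R ^+ 3)^-1.

Lemma invpow32_gt0 n : 0 < invpow32 n.
Proof. by rewrite invr_gt0 exprn_gt0// sqrtr_gt0. Qed.

(** Comparison with the integral of x ^ (-3/2), whose primitive is a multiple of
    x ^ (-1/2); the constant 6 leaves room for sqrt (n + 2) <= 2 sqrt (n + 1). *)
Lemma invpow32_telescope n : invpow32 n <= 6 / Num.sqrt n.+1%:R - 6 / Num.sqrt n.+2%:R.
Proof.
rewrite /invpow32; set x := Num.sqrt n.+1%:R; set y := Num.sqrt n.+2%:R.
have x2 : x ^+ 2 = n.+1%:R by rewrite sqr_sqrtr.
have y2 : y ^+ 2 = x ^+ 2 + 1 by rewrite x2 sqr_sqrtr// natr1.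
have x0 : 0 < x by rewrite sqrtr_gt0.
have y0 : 0 < y by rewrite sqrtr_gt0.
have n1 : 1 <= n.+1%:R :> R by rewrite ler1n.
have x1 : 1 <= x by nra.
have yx : y <= 2 * x by nra.
rewrite (_ : 6 / x - 6 / y = 6 * (y - x) / (x * y)); last by field; rewrite !gt_eqF.
have E : (y - x) = (x + y)^-1.
  apply: (mulIf (lt0r_neq0 (addr_gt0 x0 y0))); rewrite mulVf ?gt_eqF ?addr_gt0//; lra.
rewrite E -mulrA -invfM ler_pdivlMr ?mulr_gt0 ?addr_gt0//.
rewrite mulrC ler_pdivrMr ?exprn_gt0//.
have h1 : x * y <= 2 * x ^+ 2 by nra.
have h2 : x + y <= 3 * x by lra.
have : (x + y) * (x * y) <= (3 * x) * (2 * x ^+ 2).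
  by rewrite ler_pM// ?mulr_ge0 ?addr_ge0// ltW.
by rewrite exprS; lra.
Qed.

Lemma rsummable_invpow32 : rsummable setT invpow32.
Proof.
apply: (@rsummable_series_le _ _ 6) => n; first exact/ltW/invpow32_gt0.
suff : series invpow32 n <= 6 - 6 / Num.sqrt n.+1%:R.
  by move=> h; apply: le_trans h _; rewrite gerBl divr_ge0// sqrtr_ge0.
rewrite /series/=; elim: n => [|n IH]; first by rewrite big_geq// sqrtr1 divr1 subrr.
by rewrite big_nat_recr//=; have := invpow32_telescope n; lra.
Qed.

Lemma rsummable_absz (u : nat -> R) : (forall n, 0 <= u n) -> rsummable setT u ->
  rsummable setT (fun n => u n.+1) -> rsummable setT (fun z : int => u (absz z)).
Proof.
move=> u0 su su1; rewrite /rsummable/summable.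
have E : [set: int] = Posz @` setT `|` Negz @` setT.
  apply/seteqP; split => // z _; case: z => n; [left|right]; by exists n.
rewrite (esumID (Posz @` setT)) ?setTI//.
rewrite (_ : ~` _ = Negz @` setT); last first.
  apply/seteqP; split=> [z /= h|z /= [n _ <-] [m _]] //.
  by case: z h => n h; [case: h; exists n|exists n].
rewrite !esum_image; last 2 first.
  by move=> m n _ _ [].
  by move=> m n _ _ [].
by apply: lte_add_pinfty.
Qed.

(** A product of functions of the two entries, so that summability over rows reduces
    to summability over the natural numbers. *)
Definition lattice_weight p : R := invpow32 (absz p.1) * invpow32 (absz p.2).

Lemma lattice_weight_gt0 p : 0 < lattice_weight p.
Proof. by rewrite mulr_gt0 ?invpow32_gt0. Qed.

Lemma rsummable_prod (I J : choiceType) (u : I -> R) (v : J -> R) :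
  (forall i, 0 <= u i) -> (forall j, 0 <= v j) -> rsummable setT u -> rsummable setT v ->
  rsummable setT (fun p : I * J => u p.1 * v p.2).
Proof.
move=> u0 v0 su sv; rewrite /rsummable/summable.
have -> : [set: I * J] = [set: I] `*`` (fun=> [set: J]) by apply/seteqP; split.
rewrite -(@esum_esum _ _ _ _ _ (fun i j => `|(u i * v j)%:E|%E))//.
have fv := fin_esum sv (fun j _ => v0 j).
apply: (@le_lt_trans _ _ (\esum_(i in [set: I]) (nnsum setT v * u i)%:E)%E).
  apply: le_esum => i _.
  under eq_esum do rewrite /= ger0_norm ?mulr_ge0//.
  apply: le_trans (esumZ_le (u0 i) (fun j _ => v0 j)) _.
  by rewrite -(fineK fv) -EFinM mulrC.
have := rsummableZ (nnsum setT v) su; rewrite /rsummable/summable; apply: le_lt_trans.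
by apply: le_esum => i _; rewrite lee_fin ler_norm.
Qed.

Lemma rsummable_lattice_weight : rsummable setT lattice_weight.
Proof.
have s1 : rsummable setT (fun z : int => invpow32 (absz z)).
  apply: rsummable_absz; [by move=> n; exact/ltW/invpow32_gt0|exact: rsummable_invpow32|].
  apply: (rsummable_le rsummable_invpow32) => n _; rewrite ger0_norm ?(ltW (invpow32_gt0 _))//.
  rewrite lef_pV2 ?posrE ?exprn_gt0 ?sqrtr_gt0//.
  by rewrite lerXn2r ?nnegrE ?sqrtr_ge0// ler_sqrt// ler_nat.
have w0 (z : int) : 0 <= invpow32 (absz z) by exact/ltW/invpow32_gt0.
exact: (rsummable_prod w0 w0 s1 s1).
Qed.

Definition linform tau p : R[i] := p.1%:~R * tau + p.2%:~R.

Lemma linform_im tau p : upper_half tau ->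
  `|p.1%:~R| * complex.Im tau <= normc (linform tau p).
Proof.
move=> ut; apply: le_trans (Im_le_normc _).
by rewrite ImD Im_int_mul intC /= addr0 normrM [`|complex.Im _|]gtr0_norm.
Qed.

(** The imaginary part of m tau + n controls m, and then its real part controls n. *)
Lemma linform_ge tau p (e A : R) : 0 < e -> e <= complex.Im tau ->
  `|complex.Re tau| <= A ->
  `|p.1%:~R| <= (e^-1 + 1 + A / e) * normc (linform tau p) /\
  `|p.2%:~R| <= (e^-1 + 1 + A / e) * normc (linform tau p).
Proof.
move=> e0 ey xA; have ut : upper_half tau by exact: lt_le_trans ey.
have N0 := normc_ge0 (linform tau p).
have A0 : 0 <= A by exact: le_trans xA.
have Ae : 0 <= A / e by rewrite divr_ge0// ltW.
have m1 : `|p.1%:~R| <= e^-1 * normc (linform tau p).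
  rewrite mulrC ler_pdivlMr//; apply: le_trans (linform_im p ut).
  by rewrite ler_wpM2l.
have ei : 0 < e^-1 by rewrite invr_gt0.
split.
  by apply: le_trans m1 _; rewrite ler_wpM2r//; lra.
have n1 : `|p.1%:~R * complex.Re tau + p.2%:~R| <= normc (linform tau p).
  apply: le_trans (Re_le_normc _); rewrite /linform !intC ReD ReZ /=.
  by [].
have -> : p.2%:~R = (p.1%:~R * complex.Re tau + p.2%:~R) - p.1%:~R * complex.Re tau by ring.
apply: le_trans (ler_normB _ _) _; rewrite normrM.
have : `|p.1%:~R| * `|complex.Re tau| <= (e^-1 * normc (linform tau p)) * A.
  by rewrite ler_pM.
move=> h; apply: le_trans (lerD n1 h) _.
rewrite (_ : _ + _ = (1 + A / e) * normc (linform tau p)); last by ring.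
by rewrite ler_wpM2r//; lra.
Qed.

(** Convergence of the series, uniformly on bounded vertical strips away from the
    real line: three of the k factors are compared with the weight, the other ones
    are bounded. *)
Lemma lattice_term_le (k : nat) (e A : R) : (3 <= k)%N -> 0 < e ->
  exists K : R, forall tau, e <= complex.Im tau -> `|complex.Re tau| <= A ->
    forall p, nonzero_rows p -> (normc (linform tau p) ^+ k)^-1 <= K * lattice_weight p.
Proof.
move=> k3 e0; set C := e^-1 + 1 + A / e.
exists ((2 * C) ^+ 3 * C ^+ (k - 3)) => tau ey xA p p0.
have A0 : 0 <= A by exact: le_trans xA.
have Ae : 0 <= A / e by rewrite divr_ge0// ltW.
have ei : 0 < e^-1 by rewrite invr_gt0.
have C0 : 0 < C by rewrite /C; lra.
have ut : upper_half tau by exact: lt_le_trans ey.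
have N0 : 0 < normc (linform tau p).
  by rewrite normc_gt0; apply: linform_neq0 => //; case: (p) p0.
have [h1 h2] := linform_ge p e0 ey xA; rewrite -/C in h1 h2.
set N := normc _ in N0 h1 h2 *.
have E (z : int) : `|z%:~R| = (absz z)%:R :> R by rewrite -intr_norm -abszE.
rewrite !E in h1 h2.
have CN1 : 1 <= C * N.
  have [z|z] : (0 < absz p.1)%N \/ (0 < absz p.2)%N.
    move: p0; rewrite /nonzero_rows/=; case: (p) => a b /=.
    rewrite !lt0n !absz_eq0 xpair_eqE; by case: eqP; case: eqP; auto.
  - by apply: le_trans h1; rewrite ler1n.
  - by apply: le_trans h2; rewrite ler1n.
(* Each entry of the row is at most C N and 1 <= C N, so that the weights
   |m| + 1 and |n| + 1 are at most 2 C N. *)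
have W : (lattice_weight p)^-1 <= (2 * C * N) ^+ 3.
  rewrite /lattice_weight /invpow32 -invfM invrK -exprMn -sqrtrM//.
  rewrite lerXn2r ?nnegrE ?sqrtr_ge0 ?mulr_ge0 ?(ltW C0) ?(ltW N0)//.
  rewrite -[leRHS]ger0_norm ?mulr_ge0 ?(ltW C0) ?(ltW N0)// -sqrtr_sqr ler_wsqrtr//.
  rewrite -!natr1 expr2 ler_pM ?addr_ge0//; lra.
have w0 := lattice_weight_gt0 p.
have -> : N ^+ k = N ^+ 3 * N ^+ (k - 3) by rewrite -exprD subnKC.
rewrite invfM -mulrA [C ^+ _ * _]mulrC mulrA ler_pM ?invr_ge0 ?exprn_ge0 ?(ltW N0)//.
  rewrite -[lattice_weight p]invrK ler_pdivlMr ?invr_gt0//.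
  rewrite mulrC ler_pdivrMr ?exprn_gt0// -exprMn.
  exact: W.
rewrite -exprVn lerXn2r ?nnegrE ?invr_ge0 ?(ltW N0) ?(ltW C0)//.
by rewrite -[N^-1]mul1r ler_pdivrMr.
Qed.

End LatticeSum.

(** * Eisenstein series with bounded coefficients *)

(** By induction on k, since (1 + z) times the remainder for k + 1 is the remainder
    for k plus (k + 1) z ^ 2. *)
Lemma inv_pow_taylor1 {R : realType} (k : nat) : exists2 C : R, 0 <= C &
  forall z : R[i], normc z <= 2^-1 ->
    normc ((1 + z) ^- k - 1 + k%:R * z) <= C * normc z ^+ 2.
Proof.
elim: k => [|k [C C0 IH]].
  by exists 0 => // z _; rewrite expr0 invr1 subrr add0r mul0r normc0 mul0r.
exists (2 * (C + k.+1%:R)); first by rewrite mulr_ge0// addr_ge0.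
move=> z z2; have N1 : 2^-1 <= normc (1 + z).
  by apply: le_trans (normcB_ge _ _); rewrite normc1; lra.
have z1 : 1 + z != 0 by rewrite -normc_gt0; apply: lt_le_trans N1; rewrite invr_gt0.
have -> : (1 + z) ^- k.+1 - 1 + k.+1%:R * z =
   ((1 + z) ^- k - 1 + k%:R * z + k.+1%:R * z ^+ 2) / (1 + z).
  rewrite exprS invfM -natr1; move: ((1 + z) ^- k) => w.
  by field.
rewrite normcM normcV ler_pdivrMr; last by rewrite normc_gt0.
apply: le_trans (normcD _ _) _.
have : normc (k.+1%:R * z ^+ 2) <= k.+1%:R * normc z ^+ 2.
  by rewrite normcM normc_nat normcX.
move=> h; apply: le_trans (lerD (IH _ z2) h) _; rewrite -mulrDl.
rewrite [leRHS](_ : _ = (C + k.+1%:R) * normc z ^+ 2 * (2 * normc (1 + z))); last by ring.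
rewrite ler_peMr ?mulr_ge0 ?addr_ge0 ?exprn_ge0 ?normc_ge0//.
lra.
Qed.

Section EisensteinSeries.
Context {R : realType}.
Variables (k : nat) (D : set (int * int)) (c : int * int -> R[i]) (M : R).
Hypothesis k3 : (3 <= k)%N.
Hypothesis D0 : D `<=` nonzero_rows.
Hypothesis cM : forall p, D p -> normc (c p) <= M.
Implicit Types (tau : R[i]) (p : int * int).

(** The two series of the theorem are instances, for suitable sets of rows D and
    bounded coefficients c. *)
Definition eis_term tau p : R[i] := linform tau p ^- k * c p.
Definition eis tau : R[i] := csum D (eis_term tau).

Let lin_neq0 tau p : upper_half tau -> nonzero_rows p -> linform tau p != 0.
Proof. by move=> ut p0; apply: linform_neq0 => //; case: (p) p0. Qed.

Definition row_weight tau p : R := (normc (linform tau p) ^+ k)^-1.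

Lemma row_weight_ge0 tau p : 0 <= row_weight tau p.
Proof. by rewrite invr_ge0 exprn_ge0 ?normc_ge0. Qed.

Lemma rsummable_row_weight tau : upper_half tau -> rsummable nonzero_rows (row_weight tau).
Proof.
move=> ut; have [K HK] := @lattice_term_le R k _ `|complex.Re tau| k3 ut.
have := rsummableZ K (rsummable_subset (subsetT nonzero_rows) rsummable_lattice_weight).
move/rsummable_le; apply => p p0; rewrite ger0_norm ?row_weight_ge0//.
exact: HK.
Qed.

Lemma eis_csummable tau : upper_half tau -> csummable D (eis_term tau).
Proof.
move=> ut; have sw := rsummable_subset D0 (rsummable_row_weight ut).
apply: (csummable_le (rsummableZ M sw)) => p Dp.
by rewrite normcM normcV normcX mulrC ler_wpM2r ?row_weight_ge0// cM.
Qed.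

(** With u = m tau + n and z = m s / u, the term at tau + s is u ^ (-k) (1 + z) ^ (-k), and
    |z| <= |s| / Im tau does not depend on the row. Hence its second-order remainder is
    at most a constant times |s| ^ 2 |u| ^ (-k). *)
Lemma eis_cderiv tau : upper_half tau ->
  exists E, cderiv eis tau E.
Proof.
move=> ut; have y0 : 0 < complex.Im tau := ut.
have [C C0 HC] := @inv_pow_taylor1 R k.
pose e' p : R[i] := - (k%:R * p.1%:~R * linform tau p ^- k.+1 * c p).
exists (csum D e').
have sw := rsummable_subset D0 (rsummable_row_weight ut).
have cM' p : D p -> normc (c p) <= `|M| by move=> /cM /le_trans; apply; exact: ler_norm.
apply: (@csum_cderiv _ _ D (fun p w => eis_term w p) e'
  (fun p => (C * `|M| / complex.Im tau ^+ 2) * row_weight tau p) tau (complex.Im tau / 2)).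
- by rewrite divr_gt0.
- exact: rsummableZ.
- apply: (csummable_le (rsummableZ (k%:R * `|M| / complex.Im tau) sw)) => p Dp.
  have N0 : 0 < normc (linform tau p) by rewrite normc_gt0 lin_neq0//; exact: D0.
  rewrite normcN !normcM normcV normcX normc_nat normc_int exprS invfM.
  rewrite [leLHS](_ : _ = (k%:R * normc (c p)) * (`|p.1%:~R| / normc (linform tau p)) *
    row_weight tau p); last by rewrite /row_weight; ring.
  rewrite ler_wpM2r ?row_weight_ge0// ler_pM ?mulr_ge0 ?divr_ge0 ?invr_ge0 ?normc_ge0//.
    by rewrite ler_wpM2l// cM'.
  rewrite ler_pdivrMr// mulrC ler_pdivlMr//.
  exact: linform_im.
- move=> s sd; apply: eis_csummable; rewrite /upper_half/= ImD.
  by have := Im_le_normc s; rewrite ler_norml => /andP[h _]; lra.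
move=> s sd p Dp.
have u0 : linform tau p != 0 by apply: lin_neq0 => //; exact: D0.
have N0 : 0 < normc (linform tau p) by rewrite normc_gt0.
set z := p.1%:~R * s / linform tau p.
have zs : normc z <= normc s / complex.Im tau.
  rewrite /z !normcM normcV normc_int ler_pdivrMr// mulrAC ler_pdivlMr//.
  rewrite mulrAC mulrC ler_wpM2l ?normc_ge0//; exact: linform_im.
have z2 : normc z <= 2^-1.
  by apply: le_trans zs _; rewrite ler_pdivrMr// mulrC ltW.
have uE : linform (tau + s) p = linform tau p * (1 + z).
  rewrite /z mulrDr mulr1 [linform tau p * _]mulrC divfK//.
  by rewrite /linform; ring.
have -> : eis_term (tau + s) p - eis_term tau p - s * e' p =
   linform tau p ^- k * ((1 + z) ^- k - 1 + k%:R * z) * c p.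
  rewrite /eis_term uE exprMn invfM /e' exprS invfM /z; move: ((1 + _) ^+ k) => w.
  by ring.
clearbody z; rewrite !normcM normcV normcX -/(row_weight tau p).
rewrite [leRHS](_ : _ = row_weight tau p * (C * (normc s / complex.Im tau) ^+ 2) * `|M|);
  last by rewrite exprMn exprVn; ring.
rewrite ler_pM ?mulr_ge0 ?row_weight_ge0 ?normc_ge0 ?cM'//.
rewrite ler_wpM2l ?row_weight_ge0//; apply: le_trans (HC _ z2) _.
by rewrite ler_wpM2l// lerXn2r ?nnegrE ?normc_ge0 ?divr_ge0 ?normc_ge0 ?(ltW y0).
Qed.

Lemma eis_holomorphic : holomorphic_on_upper_half eis.
Proof. by move=> tau /eis_cderiv[E]; exact: cderiv_derivable. Qed.

Lemma linform_mobiusE g tau p : SL2Z g -> upper_half tau ->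
  linform (mobius g tau) p = linform tau (row_act g p) / autfactor g tau.
Proof. by move=> sg ut; rewrite /linform linform_mobius. Qed.

Lemma eis_termE g tau p : SL2Z g -> upper_half tau ->
  eis_term (mobius g tau) p =
  autfactor g tau ^+ k * (linform tau (row_act g p) ^- k * c p).
Proof.
move=> sg ut; rewrite /eis_term linform_mobiusE// exprMn invfM exprVn invrK.
by ring.
Qed.

Lemma nnsum_row_weight_act g tau : SL2Z g ->
  nnsum nonzero_rows (fun p => row_weight tau (row_act g p)) =
  nnsum nonzero_rows (row_weight tau).
Proof.
move=> sg; rewrite /nnsum [in RHS](reindex_esum nonzero_rows nonzero_rows (row_act g))//.
exact: row_act_nonzero_bij.
Qed.

Lemma rsummable_row_weight_act g tau : SL2Z g -> upper_half tau ->
  rsummable nonzero_rows (fun p => row_weight tau (row_act g p)).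
Proof.
move=> sg ut; have := rsummable_row_weight ut; rewrite /rsummable/summable.
by rewrite (reindex_esum nonzero_rows nonzero_rows (row_act g))//; exact: row_act_nonzero_bij.
Qed.

(** Reindexing by a translation matrix brings the real part of tau into a bounded
    interval without changing the sum. *)
Lemma nnsum_row_weight_bound : exists K : R, forall tau, 1 <= complex.Im tau ->
  nnsum nonzero_rows (row_weight tau) <= K.
Proof.
have [K HK] := @lattice_term_le R k 1 1 k3 ltr01.
have sW := rsummable_subset (subsetT nonzero_rows) (@rsummable_lattice_weight R).
exists (nnsum nonzero_rows (fun p => K * lattice_weight p)) => tau t1.
(* T translates sigma, of real part in [0, 1), to tau. *)
pose n := Num.floor (complex.Re tau); pose T := mat2 1 n 0 1.
have sT : SL2Z T by apply: SL2Z_mat2; rewrite mulr0 subr0 mulr1.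
pose sigma := tau - n%:~R.
have Is : complex.Im sigma = complex.Im tau by rewrite ImD ImN intC /= oppr0 addr0.
have us : upper_half sigma by rewrite /upper_half/= Is; lra.
have Rs : `|complex.Re sigma| <= 1.
  rewrite ReD ReN intC /= ger0_norm ?subr_ge0 ?floor_le//.
  by rewrite lerBlDl ltW// -[X in _ + X]/(1%:~R) -rmorphD floorD1_gt.
have jT : autfactor T sigma = 1 by rewrite /autfactor !mat2E mul0r add0r.
have tE : tau = mobius T sigma.
  by rewrite /mobius jT divr1 !mat2E mul1r subrK.
have -> : nnsum nonzero_rows (row_weight tau) = nnsum nonzero_rows (row_weight sigma).
  rewrite -(nnsum_row_weight_act sigma sT); apply: eq_nnsum => p _.
  by rewrite /row_weight tE linform_mobiusE// jT divr1.
apply: le_nnsum; first exact: rsummableZ.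
move=> p p0; rewrite row_weight_ge0/=; apply: HK => //.
by rewrite Is.
Qed.

(** Up to coefficients, the slashed series is a subsum of the total weight at tau,
    with rows permuted by g. *)
Lemma eis_bounded g : SL2Z g -> bounded_near_ioo (slash k eis g).
Proof.
move=> sg; have [K HK] := nnsum_row_weight_bound.
exists 1, (2 * (`|M| * K)); split => // tau t1.
have ut : upper_half tau by rewrite /upper_half/=; lra.
rewrite -normc_normr lecR.
have jk : autfactor g tau ^+ k != 0 by rewrite expf_neq0// autfactor_neq0.
have -> : slash k eis g tau = csum D (fun p => linform tau (row_act g p) ^- k * c p).
  rewrite /slash /eis mulrC -csumZ; last exact/eis_csummable/mobius_upper.
  by apply: eq_csum => p _; rewrite eis_termE// mulKf.
have sw := rsummable_subset D0 (rsummable_row_weight_act sg ut).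
apply: le_trans (csum_norm (rsummableZ `|M| sw) _) _.
  move=> p Dp; rewrite normcM normcV normcX mulrC.
  by rewrite ler_wpM2r ?row_weight_ge0// (le_trans (cM Dp))// ler_norm.
rewrite nnsumZ//; last by move=> *; exact: row_weight_ge0.
rewrite ler_wpM2l// ler_wpM2l//; apply: le_trans (HK _ (ltW t1)).
rewrite -(nnsum_row_weight_act tau sg).
apply: nnsum_subset => //; first exact: rsummable_row_weight_act.
by move=> p; exact: row_weight_ge0.
Qed.

(** Replacing tau by g tau moves g to the rows; the sum is then reindexed. *)
Lemma eis_transform g tau (w : R[i]) : SL2Z g -> upper_half tau ->
  set_bij D D (row_act g) ->
  (forall p, D p -> c p = c (row_act g p) * w) ->
  eis (mobius g tau) = autfactor g tau ^+ k * eis tau * w.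
Proof.
move=> sg ut bD cE.
rewrite /eis -[in RHS](csum_reindex _ bD) mulrAC -csumZ.
  by apply: eq_csum => p Dp; rewrite eis_termE// cE// /eis_term; ring.
have [fD _ _] := bD.
have sw := rsummable_subset D0 (rsummable_row_weight_act sg ut).
apply: (csummable_le (rsummableZ M sw)) => p Dp.
rewrite normcM normcV normcX mulrC ler_wpM2r ?row_weight_ge0// cM//.
exact: fD.
Qed.

End EisensteinSeries.

(** * Twisted Eisenstein series *)

Section Congruence.
Variable l : nat.
Implicit Types (g : 'M[int]_2) (p : int * int).

Lemma Gamma1_Gamma0 g : Gamma1 l g -> Gamma0 l g.
Proof. by case. Qed.

Lemma Gamma0_inv g : Gamma0 l g -> Gamma0 l (inv2 g).
Proof.
move=> [sg lg]; split; first exact: SL2Z_inv.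
by rewrite !mat2E rpredN.
Qed.

Lemma Gamma1_inv g : Gamma1 l g -> Gamma1 l (inv2 g).
Proof. by move=> [G0 a1 d1]; split; rewrite ?mat2E//; exact: Gamma0_inv. Qed.

Lemma Gamma1_row2 g p : Gamma1 l g -> (l %| p.1)%Z ->
  exists t : int, (row_act g p).2 = p.2 + t * l.
Proof.
move=> [_ _ /eqP]; rewrite eqz_mod_dvd => /dvdzP[b gb] /dvdzP[a pa].
exists (a * g 0 1 + p.2 * b); rewrite /row_act /= pa.
have -> : g 1 1 = 1 + b * l by rewrite -gb addrC subrK.
by ring.
Qed.

Lemma Gamma0_row1 g p : Gamma0 l g -> (l %| p.1)%Z -> (l %| (row_act g p).1)%Z.
Proof.
move=> [_ lg] lp; rewrite /row_act /=.
by rewrite rpredD ?(dvdz_mulr _ lp) ?(dvdz_mull _ lg).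
Qed.

Lemma Eis_index_act g p : Gamma1 l g -> Eis_index l p -> Eis_index l (row_act g p).
Proof.
move=> Gg [lp cp p0]; have G0 := Gamma1_Gamma0 Gg; split.
- exact: Gamma0_row1.
- have [t ->] := Gamma1_row2 Gg lp.
  by rewrite /coprimez addrC gcdzMDl.
- exact: (row_act_nonzero G0.1 p0).
Qed.

Lemma Eis_hat_index_nonzero p : Eis_hat_index l p -> p != (0, 0).
Proof. by move=> [_]; apply: contraTneq => ->. Qed.

Lemma Eis_hat_index_act g p : Gamma1 l g -> Eis_hat_index l p ->
  Eis_hat_index l (row_act g p).
Proof.
move=> Gg [lp /coprimezP[[u v] /= uv]]; have G0 := Gamma1_Gamma0 Gg; split.
  exact: Gamma0_row1.
have dg := SL2Z_det G0.1.
apply/coprimezP; exists (u * g 1 1 - v * g 0 1, v * g 0 0 - u * g 1 0) => /=.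
rewrite (_ : _ + _ = (u * p.1 + v * p.2) * (g 0 0 * g 1 1 - g 0 1 * g 1 0)); last by ring.
by rewrite uv dg.
Qed.

(** For l = 1 the type is Z/2, whose only unit is 1. *)
Lemma unit_class_period (hl : (1 <= l)%N) (d t : int) :
  unit_class l (d + t * l) = unit_class l d.
Proof.
move: hl; rewrite leq_eqVlt => /orP[/eqP <-|l1].
  have H (u v : {unit 'Z_1}) : u = v.
    apply/val_inj; have := valP u; have := valP v.
    by case: (val u) => [[|[|//]] ?]; case: (val v) => [[|[|//]] ?] //= *; exact: val_inj.
  exact: H.
rewrite /unit_class rmorphD rmorphM /=.
have -> : (l : int)%:~R = 0 :> 'Z_l by rewrite -pmulrn pchar_Zp.
by rewrite mulr0 addr0.
Qed.

End Congruence.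

Section Twist.
Context {R : realType}.
Variables (l : nat) (h : R[i] -> R[i]).
Hypothesis l0 : (0 < l)%N.
Hypothesis hh : cusp_form 2 l h.
Implicit Types (g : 'M[int]_2) (p : int * int).

(** The cocycle identity. If the row p corresponds to the cusp x = - n / m and (c, d) is the
    lower row of g, then p g corresponds to g^-1 x, and the integral from i oo to g^-1 x
    splits at g^-1 oo = - d / c. *)
Theorem cusp_integral_act g p : Gamma0 l g -> nonzero_rows p ->
  cusp_integral h (row_act g p).1 (row_act g p).2 =
  cusp_integral h p.1 p.2 + cusp_integral h (g 1 0) (g 1 1).
Proof.
have h1 : cuspidal_q_expansion l h.
  have [_ _ /(_ 1%:M)] := hh; rewrite /SL2Z/= det1 => /(_ erefl).
  congr cuspidal_q_expansion; apply/funext => tau.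
  by rewrite /slash mobius1 autfactor1 expr1n invr1 mulr1.
have [F [dF decF]] := q_expansion_primitive l0 h1.
case: p => m n Gg p0; have G0 := Gg.1.
set t := gcdz m n.
have t0 : t != 0 by rewrite gcdz_eq0; move: p0; rewrite /nonzero_rows/= xpair_eqE.
have /dvdzP[m' mE] := dvdz_gcdl m n; have /dvdzP[n' nE] := dvdz_gcdr m n.
rewrite -/t in mE nE.
have [u [v uv]] := Bezoutz m n; rewrite -/t in uv.
have uv1 : u * m' + v * n' = 1.
  by apply: (mulIf t0); rewrite mul1r mulrDl -!mulrA -mE -nE.
(* gam maps i oo to - n / m. *)
pose gam := mat2 (- n') (- u) m' (- v).
have sgam : SL2Z gam by apply: SL2Z_mat2; rewrite -uv1; ring.
have [C [pC _]] := period_exists l0 hh dF sgam.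
(* k is the inverse of g and maps i oo to - d / c; k gam maps i oo to the cusp
   of the row (m, n) g. *)
have Gk := Gamma0_inv Gg; have sk := Gk.1; set k := inv2 g in Gk sk.
have [E pE _] := period_Gamma0 hh dF decF Gk.
have pEC := period_mul hh dF decF Gk sgam pE pC.
have H := @cusp_integral_period _ l h F l0 hh dF decF.
have -> : cusp_integral h m n = C.
  apply: (H _ _ t gam) => //; rewrite /gam mat2E ?mE ?nE//.
  by rewrite mulNr -nE.
have -> : cusp_integral h (g 1 0) (g 1 1) = E.
  by apply: (H _ _ (-1) k) => //; rewrite /k /inv2 mat2E mulrN1 ?opprK.
rewrite addrC; apply: (H _ _ t (k *m gam)) => //; first exact: SL2Z_mul.
  by rewrite mulmx2 /k /inv2 /gam !mat2E /row_act /= {1}mE {1}nE; ring.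
by rewrite mulmx2 /k /inv2 /gam !mat2E /row_act /= {1}mE {1}nE; ring.
Qed.

Lemma twist_act g p : Gamma0 l g -> nonzero_rows p ->
  twist h p.1 p.2 = twist h (row_act g p).1 (row_act g p).2 *
    e2pi (- (complex.Re (cusp_integral h (g 1 0) (g 1 1)))%:C).
Proof.
move=> Gg p0; rewrite /twist cusp_integral_act// -e2piD ReD rmorphD/=.
by rewrite addrK.
Qed.

Lemma normc_twist (c d : int) : normc (twist h c d) = 1.
Proof. exact: normc_e2pi_real. Qed.

(** Both series of the theorem at once: phi stands for the additive or multiplicative
    character, which only depends on the second entry modulo l. *)
Theorem twisted_eis (k : nat) (D : set (int * int)) (phi : int * int -> R[i]) (M : R) :
  (3 <= k)%N -> D `<=` nonzero_rows ->
  (forall p, D p -> normc (phi p) <= M) ->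
  (forall g p, Gamma1 l g -> D p -> D (row_act g p)) ->
  (forall g p, Gamma1 l g -> D p -> phi (row_act g p) = phi p) ->
  let c p := phi p * twist h p.1 p.2 in
  (forall tau, upper_half tau -> abs_summable D (eis_term k c tau)) /\
  twisted_modular_form l h k (eis k D c).
Proof.
move=> k3 D0 phiM Dact phiact c.
have cM p : D p -> normc (c p) <= M.
  by move=> Dp; rewrite normcM normc_twist mulr1 phiM.
split; first by move=> tau; exact: (eis_csummable k3 D0 cM).
split.
- exact: (eis_holomorphic k3 D0 cM).
- move=> g tau Gg ut; have G0 := Gamma1_Gamma0 Gg; have sg := G0.1.
  apply: (eis_transform k3 D0 cM) => //.
    apply: row_act_bij => // p; first exact: Dact.
    exact/Dact/Gamma1_inv.
  move=> p Dp; rewrite /c (phiact g)// -mulrA -twist_act//.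
  exact: D0.
- by move=> g; exact: (eis_bounded k3 D0 cM).
Qed.

End Twist.

Theorem proposition3p2 (R : realType) (l : nat) (hl : (1 <= l)%N)
    (h : R[i] -> R[i]) (hh : cusp_form 2 l h)
    (i : 'I_l) (chi : {unit 'Z_l} -> R[i]) (hchi : is_character chi)
    (k : nat) (hk : (3 <= k)%N) :
  [/\ forall tau, upper_half tau ->
        abs_summable (Eis_index l) (Eis_term k i h tau),
      twisted_modular_form l h k (Eis k i h),
      forall tau, upper_half tau ->
        abs_summable (Eis_hat_index l) (Eis_hat_term k chi h tau)
    & twisted_modular_form l h k (Eis_hat k chi h)].
Proof.
pose phi (p : int * int) : R[i] := e2pi (- (p.2%:~R * i%:R / l%:R)).
pose psi (p : int * int) : R[i] := chi (unit_class l p.2).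
have lC : l%:R != 0 :> R[i] by rewrite pnatr_eq0 -lt0n.
have phiM p : Eis_index l p -> normc (phi p) <= 1.
  move=> _; rewrite /phi (_ : - _ = (- (p.2%:~R * i%:R / l%:R))%:C) ?normc_e2pi_real//.
  by rewrite !natC intC -fmorphV -!rmorphM -rmorphN.
have phi_act g p : Gamma1 l g -> Eis_index l p -> phi (row_act g p) = phi p.
  move=> Gg [lp _ _]; rewrite /phi; have [t ->] := Gamma1_row2 Gg lp.
  rewrite (_ : - _ = - (p.2%:~R * i%:R / l%:R) + (- (t * i))%:~R).
    by rewrite e2piD e2pi_int mulr1.
  rewrite rmorphN rmorphD !rmorphM /= -!pmulrn.
  by field.
have psiM p : Eis_hat_index l p -> normc (psi p) <= \sum_u normc (chi u).
  move=> _; rewrite (bigD1 (unit_class l p.2))//= lerDl sumr_ge0// => u _.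
  exact: normc_ge0.
have psi_act g p : Gamma1 l g -> Eis_hat_index l p -> psi (row_act g p) = psi p.
  move=> Gg [lp _]; rewrite /psi; have [t ->] := Gamma1_row2 Gg lp.
  by rewrite unit_class_period.
have [S1 T1] := twisted_eis hl hh hk
  (fun p (Dp : Eis_index l p) => let: And3 _ _ p0 := Dp in p0) phiM (@Eis_index_act l) phi_act.
have [S2 T2] := twisted_eis hl hh hk
  (@Eis_hat_index_nonzero l) psiM (@Eis_hat_index_act l) psi_act.
have E1 tau : Eis_term k i h tau = eis_term k (fun p => phi p * twist h p.1 p.2) tau.
  by apply/funext => p; rewrite /Eis_term /eis_term mulrA.
have E2 tau : Eis_hat_term k chi h tau = eis_term k (fun p => psi p * twist h p.1 p.2) tau.
  by apply/funext => p; rewrite /Eis_hat_term /eis_term mulrA.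
split.
- by move=> tau ut; rewrite E1; exact: S1.
- have -> // : Eis k i h = eis k (Eis_index l) (fun p => phi p * twist h p.1 p.2).
  by apply/funext => tau; rewrite /Eis E1.
- by move=> tau ut; rewrite E2; exact: S2.
- have -> // : Eis_hat k chi h = eis k (Eis_hat_index l) (fun p => psi p * twist h p.1 p.2).
  by apply/funext => tau; rewrite /Eis_hat E2.
Qed.
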